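(* Let $\mathbb{X}=\{x_1,\dots,x_n\}$ and $\mathbb{Y}=\{y_1,\dots,y_m\}$ be two alphabets of indeterminates of cardinality $n$ and $m$, and let $\mathbb{B}=1+\mathbb{Y}=\{1\}\cup\mathbb{Y}$, an alphabet with $m+1$ letters. Let $k$ be an integer with $k<n$. Then $$\pi_\omega\left(\sum_{j=0}^{\infty} x_1^{j-k}S^j(\mathbb{B})\right)=\underset{\geq}{\Omega}\,\frac{\lambda^k}{(1-x_1\lambda)\cdots(1-x_n\lambda)\left(1-\frac{y_1}{\lambda}\right)\cdots\left(1-\frac{y_m}{\lambda}\right)}=\frac{\sum_{\mu}(-1)^{|\mu|}S_{\mu'}(\mathbb{B})\,S_{-k,\,\mu}(\mathbb{X})}{R(1,\mathbb{X}\mathbb{B})},$$ where the sum is over all partitions $\mu=[\mu_1,\dots,\mu_{n-1}]$ (with $\mu_1\ge\dots\ge\mu_{n-1}\ge 0$; only finitely many terms are nonzero), $|\mu|$ is the sum of the parts of $\mu$, $\mu'$ is the conjugate partition of $\mu$, and $-k,\mu$ denotes the vector $[-k,\mu_1,\dots,\mu_{n-1}]\in\mathbb{Z}^n$.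
   Context: Complete symmetric functions. For a finite alphabet $\mathbb{A}$, $S^j(\mathbb{A})$ is defined by $\sum_{j\ge 0}S^j(\mathbb{A})\lambda^j=\prod_{a\in\mathbb{A}}(1-a\lambda)^{-1}$, with $S^j(\mathbb{A})=0$ for $j<0$. Schur functions. For a vector $v=[v_1,\dots,v_r]\in\mathbb{Z}^r$ (not necessarily a partition), $S_v(\mathbb{A})=\det\left(S^{v_i-i+j}(\mathbb{A})\right)_{1\le i,j\le r}$. For a partition this does not depend on the number of trailing zeros. Product notation. $R(1,\mathbb{X}\mathbb{B})=\prod_{x\in\mathbb{X},\,b\in\mathbb{B}}(1-xb)$. MacMahon's Omega operator (one variable $\lambda$). $\underset{\geq}{\Omega}\sum_{s=-\infty}^{\infty}A_s\lambda^s=\sum_{s=0}^{\infty}A_s$. The rational function in $\lambda$ is expanded as a formal power series in the $x_i$ and the $y_j$, i.e. $\frac{1}{1-x_i\lambda}=\sum_{a\ge0}x_i^a\lambda^a$ and $\frac{1}{1-y_j/\lambda}=\sum_{b\ge0}y_j^b\lambda^{-b}$. Symmetrizing operator. $\pi_\omega$ is defined by $$\pi_\omega f(x_1,\dots,x_n)=\sum_{\sigma\in\mathfrak{S}(\mathbb{X})}\sigma\left(\frac{f(x_1,\dots,x_n)}{\Delta(\mathbb{X})}\,x_1^{n-1}x_2^{n-2}\cdots x_n^{0}\right),\qquad \Delta(\mathbb{X})=\prod_{1\le i<j\le n}(x_i-x_j),$$ where the sum is over all permutations $\sigma$ in the symmetric group on $\mathbb{X}$, acting by permuting $x_1,\dots,x_n$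 (and fixing the letters of $\mathbb{Y}$). Identities are between formal series: $\pi_\omega$ preserves the total degree in $x_1,\dots,x_n$ and is applied term by term (degree by degree in the $x$'s) to infinite sums, and $1/R(1,\mathbb{X}\mathbb{B})$ is expanded as a power series in the $x_i$. *)

(* Defs.v *)
From HB Require Import structures.
From mathcomp Require Import all_boot all_order all_algebra perm.
From mathcomp Require Import boolp classical_sets functions cardinality fsbigop.
From mathcomp Require Import mpoly.

Set Implicit Arguments.
Unset Strict Implicit.
Unset Printing Implicit Defensive.

Import GRing.Theory.

Local Open Scope ring_scope.

                                                                          
                                                                                

Record mseries (n : nat) (R : Type) := MSeries {
  mseries_coef :> 'X_{1..n} -> R
}.

Notation "{ 'mseries' R [ n ] }" := (mseries n R)
  (at level 0, R, n at level 2, format "{ 'mseries'  R [ n ] }") : type_scope.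

HB.instance Definition _ n R := gen_eqMixin {mseries R[n]}.
HB.instance Definition _ n R := gen_choiceMixin {mseries R[n]}.

Lemma mseriesP n R (F G : {mseries R[n]}) : (forall a, F a = G a) -> F = G.
Proof. by case: F G => [f] [g] /= fg; congr MSeries; apply/funext. Qed.

Section MSeriesRing.
Variables (n : nat) (R : comNzRingType).
Implicit Types F G H : {mseries R[n]}.

Definition mseries_of (p : {mpoly R[n]}) : {mseries R[n]} :=
  MSeries (fun a => p@_a).

Definition mseries_add F G : {mseries R[n]} := MSeries (fun a => F a + G a).
Definition mseries_opp F : {mseries R[n]} := MSeries (fun a => - F a).
Definition mseries_mul F G : {mseries R[n]} := MSeries (fun a =>
  \sum_(k : 'X_{1..n < (mdeg a).+1, (mdeg a).+1} | a == (k.1 + k.2)%MM)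
     F k.1 * G k.2).

Fact mseries_addA : associative mseries_add.
Proof. by move=> F G H; apply: mseriesP => a /=; rewrite addrA. Qed.
Fact mseries_addC : commutative mseries_add.
Proof. by move=> F G; apply: mseriesP => a /=; rewrite addrC. Qed.
Fact mseries_add0 : left_id (mseries_of 0) mseries_add.
Proof. by move=> F; apply: mseriesP => a /=; rewrite mcoeff0 add0r. Qed.
Fact mseries_addN : left_inverse (mseries_of 0) mseries_opp mseries_add.
Proof. by move=> F; apply: mseriesP => a /=; rewrite mcoeff0 addNr. Qed.

HB.instance Definition _ := GRing.isZmodule.Build {mseries R[n]}
  mseries_addA mseries_addC mseries_add0 mseries_addN.

                                                                                
Let trunc d F : {mpoly R[n]} := \sum_(a : 'X_{1..n < d}) F a *: 'X_[a].

Let mcoeff_trunc d F (a : 'X_{1..n}) : (mdeg a < d)%N -> (trunc d F)@_a = F a.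
Proof. exact: mcoeff_mpoly. Qed.

Let mseries_mulE F G (a : 'X_{1..n}) (p q : {mpoly R[n]}) :
    (forall b : 'X_{1..n}, (mdeg b <= mdeg a)%N -> p@_b = F b) ->
    (forall b : 'X_{1..n}, (mdeg b <= mdeg a)%N -> q@_b = G b) ->
  mseries_mul F G a = (p * q)@_a.
Proof.
move=> pF qG; rewrite mcoeffM /=; apply: eq_bigr => k _.
by rewrite pF ?qG // -ltnS; [exact: (bmdeg k.2) | exact: (bmdeg k.1)].
Qed.

Let truncE d F (a : 'X_{1..n}) : (mdeg a < d)%N ->
  forall b : 'X_{1..n}, (mdeg b <= mdeg a)%N -> (trunc d F)@_b = F b.
Proof. by move=> ad b ba; rewrite mcoeff_trunc // (leq_ltn_trans ba). Qed.

Fact mseries_mulA : associative mseries_mul.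
Proof.
move=> F G H; apply: mseriesP => a; pose T := trunc (mdeg a).+1.
have TF F' := truncE F' (ltnSn (mdeg a)).
have TM F1 F2 b : (mdeg b <= mdeg a)%N -> (T F1 * T F2)@_b = mseries_mul F1 F2 b.
  by move=> ba; apply/esym/mseries_mulE => c cb; apply/TF/(leq_trans cb).
rewrite (mseries_mulE (TF F) (TM G H)) (mseries_mulE (TM F G) (TF H)).
by rewrite mulrA.
Qed.

Fact mseries_mulC : commutative mseries_mul.
Proof.
move=> F G; apply: mseriesP => a.
have TF F' := truncE F' (ltnSn (mdeg a)).
by rewrite (mseries_mulE (TF F) (TF G)) (mseries_mulE (TF G) (TF F)) mulrC.
Qed.

Fact mseries_mul1 : left_id (mseries_of 1) mseries_mul.
Proof.
move=> F; apply: mseriesP => a.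
have TF := truncE F (ltnSn (mdeg a)).
by rewrite (@mseries_mulE _ _ _ 1 _ _ TF) // mul1r TF.
Qed.

Fact mseries_mulDl : left_distributive mseries_mul mseries_add.
Proof.
move=> F G H; apply: mseriesP => a /=; rewrite -big_split /=.
by apply: eq_bigr => k _; rewrite mulrDl.
Qed.

Fact mseries_oner_neq0 : mseries_of 1 != mseries_of 0.
Proof.
apply/eqP => /(congr1 (fun F : {mseries R[n]} => F 0%MM)) /= /eqP.
by rewrite mcoeff1 mcoeff0 eqxx oner_eq0.
Qed.

HB.instance Definition _ := GRing.Zmodule_isComNzRing.Build {mseries R[n]}
  mseries_mulA mseries_mulC mseries_mul1 mseries_mulDl mseries_oner_neq0.

                                                                           
                                                                                
Definition mseries_unit : pred {mseries R[n]} :=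
  fun F => `[< exists G, G * F = 1 >].
Definition mseries_inv F : {mseries R[n]} := xget F [set G | G * F = 1].

Fact mseries_mulV : {in mseries_unit, left_inverse 1 mseries_inv *%R}.
Proof. by move=> F /asboolP FV; exact: (xgetPex F FV). Qed.
Fact mseries_unitP F G : G * F = 1 -> mseries_unit F.
Proof. by move=> GF; apply/asboolP; exists G. Qed.
Fact mseries_inv_out : {in [predC mseries_unit], mseries_inv =1 id}.
Proof.
by move=> F /asboolPn FnV; apply: xgetPN => G GF; apply: FnV; exists G.
Qed.

HB.instance Definition _ := GRing.ComNzRing_hasMulInverse.Build {mseries R[n]}
  mseries_mulV mseries_unitP mseries_inv_out.

End MSeriesRing.

                                                                           
                                                                                
Definition has_sum n (R : comNzRingType) (I : choiceType)
    (u : I -> {mseries R[n]}) (F : {mseries R[n]}) : Prop :=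
  forall a : 'X_{1..n},
    finite_set [set i | u i a != 0] /\ F a = \sum_(i \in [set: I]) u i a.

Section SchurFunctions.
Variable T : comNzRingType.
Implicit Types A B : seq T.

                                                                          
                                                                                
Definition Scomplete A (j : int) : T :=
  if j is Posz d then
    (\prod_(a <- A) (mseries_of (1 - a *: 'X_ord0))^-1 : {mseries T[1]})
      (U_(ord0) *+ d)%MM
  else 0.

Definition schurS A (v : seq int) : T :=
  \det (\matrix_(i < size v, j < size v)
          Scomplete A (v`_i - (i : nat)%:Z + (j : nat)%:Z)).

              
Definition R1 A B : T := \prod_(a <- A) \prod_(b <- B) (1 - a * b).

End SchurFunctions.

                                                                                
Definition partitions (r : nat) : set (r.-tuple nat) :=
  [set mu : r.-tuple nat | sorted geq mu].

Definition conjugate (mu : seq nat) : seq nat :=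
  mkseq (fun j => count (fun p => (j < p)%N) mu) (head 0%N mu).

Section Letters.
Variables (R : nzRingType) (n m : nat).

                                                                          
                                                                                
Definition x_ (i : 'I_n) : {mpoly R[n + m]} := 'X_(lshift m i).
Definition y_ (j : 'I_m) : {mpoly R[n + m]} := 'X_(rshift n j).

Definition alphaX : seq {mpoly R[n + m]} := [seq x_ i | i <- enum 'I_n].
Definition alphaY : seq {mpoly R[n + m]} := [seq y_ j | j <- enum 'I_m].

End Letters.

Notation "p %:F" := (FracField.tofrac p)
  (at level 1, format "p %:F") : ring_scope.

Section SymmetrizingOperator.
Variables (R : idomainType) (n m : nat).
Local Notation frac := {fraction {mpoly R[n + m]}}.

Definition permX (s : 'S_n) (p : {mpoly R[n + m]}) : {mpoly R[n + m]} :=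
  p \mPo [tuple match fintype.split k with
                | inl i => x_ R m (s i)
                | inr j => y_ R n j
                end | k < n + m].

                                                                      
                                                                                
Definition permX_frac (s : 'S_n) (q : frac) : frac :=
  (permX s \n_(repr q))%:F / (permX s \d_(repr q))%:F.

Definition Delta : {mpoly R[n + m]} :=
  \prod_(i < n) \prod_(j < n | (i < j)%N) (x_ R m i - x_ R m j).

Definition pi_omega (f : frac) : frac :=
  \sum_(s : 'S_n)
    permX_frac s (f / Delta%:F * (\prod_(i < n) x_ R m i ^+ (n.-1 - i))%:F).

                                                                          
                                                                            
                                                                                
Definition is_pi_omega_sum (f : nat -> frac) (F : {mseries R[n + m]}) : Prop :=
  exists2 u : nat -> {mpoly R[n + m]},
    (forall j, (u j)%:F = pi_omega (f j)) &
    has_sum (fun j => mseries_of (u j)) F.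

End SymmetrizingOperator.

Section Omega.
Variables (R : idomainType) (N : nat).

Definition lambda : {fraction {poly R}} := ('X : {poly R})%:F.

                                                                              
                                                                              
                                                                     
                                                                                
Definition lambda_expansion (E : {mseries {fraction {poly R}}[N]})
    (A : int -> {mseries R[N]}) : Prop :=
  forall a : 'X_{1..N},
    finite_set [set s | A s a != 0] /\
    E a = \sum_(s \in [set: int]) ((A s a)%:P)%:F * lambda ^ s.

                                                                                
Definition is_Omega (E : {mseries {fraction {poly R}}[N]})
    (F : {mseries R[N]}) : Prop :=
  exists2 A : int -> {mseries R[N]},
    lambda_expansion E A & has_sum (fun s : nat => A s) F.

End Omega.

                                                    
                                                      
                                                                                
Definition Omega_integrand (R : idomainType) (n m : nat) (k : int) :
    {mseries {fraction {poly R}}[n + m]} :=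
  mseries_of (lambda R ^ k)%:MP /
  mseries_of (\prod_(i < n) (1 - lambda R *: x_ _ m i) *
              \prod_(j < m) (1 - (lambda R)^-1 *: y_ _ n j)).

(* Main.v *)
Require Import Defs.
From HB Require Import structures.
From mathcomp Require Import all_boot all_order all_algebra perm.
From mathcomp Require Import boolp classical_sets functions cardinality fsbigop.
From mathcomp Require Import mpoly.
From mathcomp Require Import zify.


(** Write [S^j] for the complete functions, and [n = N + 1].

    The symmetrizing operator commutes with multiplication by [S^j(B)], and on
    [x_1^d] with [d >= - N] it is the Leibniz expansion of the alternant
    [det (x_p^(d + N), x_p^(N - 1), ..., x_p^0)] divided by the Vandermonde
    determinant, that is [S^d(X)] ([alternant_Scomplete], [pi_omega_x1]).  Since
    [k <= N], the first expression is the series [sum_j S^(j - k)(X) S^j(B)].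
    As [S^j(B)] is the sum of the [S^q(Y)] for [q <= j], a monomial of degree
    [p] in the [x]'s and [q] in the [y]'s has coefficient [1] or [0] in this
    series according to whether [q <= k + p] ([mcoeff_Scomplete_X1Y]).  In the
    rational function of lambda the same monomial has coefficient
    [lambda^(k + p - q)] ([Omega_integrandE]), so the Omega operator leaves the
    same series.

    For the rational form, let [Q(z) = prod_(b in B) (1 - b z)].  By the dual
    Jacobi-Trudi identity, [(-1)^|mu| S_(mu')(B)] is a minor of the Toeplitz
    matrix of the coefficients of [Q] ([dual_jacobi_trudi]); it vanishes when
    [mu_1] exceeds the number of letters, which makes the sum finite.  The
    Cauchy-Binet formula then turns the sum over partitions into the determinant
    [D(e)] called [Schur_sum], with [e = N - k]: its first row consists of the
    [S^(j - k)(X)], and its other rows are combinations of rows of complete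
    functions with the coefficients of [Q] ([Schur_sum_partitions]).

    Multiplying on the right by the matrix of the coefficients of the
    [prod_(i <> p) (1 - x_i z)] turns each row of complete functions into a row
    of powers of the [x_p] ([Scomplete_row_others]).  So [D(e)] times the
    Vandermonde determinant has first row [x_p^e] and other rows
    [x_p^(N - i) Q(x_p)].  Replacing [x_p^e] by [x_p^e P(x_p) Q(x_p)], one can
    take out the factor [Q(x_p)] of each column, whose product is [R(1, XB)];
    what remains is a combination of alternants.  With [P] a truncation of
    [1 / Q], this says that [R(1, XB)] times a partial sum of the series agrees
    with [D(e)] up to terms of high degree ([Schur_sum_mul],
    [R1_partial_sum]). *)

Set Implicit Arguments.
Unset Strict Implicit.
Unset Printing Implicit Defensive.

Import Order.TTheory GRing.Theory Num.Theory.

Local Open Scope ring_scope.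

(** * Arithmetic of formal series *)

Section SeriesArithmetic.
Variables (n : nat) (R : comNzRingType).
Implicit Types (p q f : {mpoly R[n]}) (F G : {mseries R[n]}) (a b : 'X_{1..n}).

Lemma mseries_addE F G a : (F + G) a = F a + G a.
Proof. by []. Qed.

Lemma mseries_mulE F G a : (F * G) a =
  \sum_(k : 'X_{1..n < (mdeg a).+1, (mdeg a).+1} | a == (k.1 + k.2)%MM)
     F k.1 * G k.2.
Proof. by []. Qed.

Lemma mseries_ofM p q : mseries_of (p * q) = mseries_of p * mseries_of q.
Proof. by apply: mseriesP => a /=; rewrite mcoeffM. Qed.

Lemma mseries_ofB p q : mseries_of (p - q) = mseries_of p - mseries_of q.
Proof. by apply: mseriesP => a /=; rewrite mcoeffB. Qed.

Lemma mseries_of_prod (I : Type) (r : seq I) (P : pred I)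
    (p_ : I -> {mpoly R[n]}) :
  mseries_of (\prod_(i <- r | P i) p_ i)
  = \prod_(i <- r | P i) mseries_of (p_ i).
Proof.
by apply: (big_morph (@mseries_of n R)) => [p q|]; [exact: mseries_ofM |].
Qed.

(** A coefficient of a product only sees the coefficients of lower degree, so
    series may be replaced there by polynomials that agree with them. *)
Lemma eq_mseries_mul F F' G G' a :
    (forall b, (mdeg b <= mdeg a)%N -> F b = F' b) ->
    (forall b, (mdeg b <= mdeg a)%N -> G b = G' b) ->
  (F * G) a = (F' * G') a.
Proof.
move=> eqF eqG; rewrite !mseries_mulE; apply: eq_bigr => k _.
by rewrite eqF ?eqG // -ltnS; [exact: (bmdeg k.2) | exact: (bmdeg k.1)].
Qed.

Lemma mseries_mulCX F c a : (mseries_of c%:MP * F) a = c * F a.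
Proof.
rewrite (@eq_mseries_mul _ (mseries_of c%:MP) F
  (mseries_of (\sum_(b : 'X_{1..n < (mdeg a).+1}) F b *: 'X_[b]))) //.
  by rewrite -mseries_ofM /= mcoeffCM mcoeff_mpoly.
by move=> b ba /=; rewrite mcoeff_mpoly.
Qed.

Lemma mcoeff_mulX p i a :
  ('X_i * p)@_a = if (0 < a i)%N then p@_(a - U_(i))%MM else 0.
Proof.
case: ifP => ai; last first.
  rewrite mcoeffM big1 // => k /eqP ak; rewrite mcoeffX.
  case: eqP => [Uk|]; last by rewrite mul0r.
  have := congr1 (fun c : 'X_{1..n} => c i) ak.
  by rewrite mnmDE -Uk mnm1E eqxx; lia.
have Ua : (U_(i) <= a)%MM.
  by apply/mnm_lepP => j; rewrite mnm1E; case: eqP => [<-|].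
by have := mcoeffMX p U_(i) (a - U_(i)); rewrite addmC submK // mulrC => ->.
Qed.

Lemma mseries_mulX F i a :
  (mseries_of 'X_i * F) a = if (0 < a i)%N then F (a - U_(i))%MM else 0.
Proof.
rewrite (@eq_mseries_mul _ (mseries_of 'X_i) F
  (mseries_of (\sum_(b : 'X_{1..n < (mdeg a).+1}) F b *: 'X_[b]))) //.
  rewrite -mseries_ofM /= mcoeff_mulX; case: ifP => // ai.
  by rewrite mcoeff_mpoly // ltnS mdegB.
by move=> b ba /=; rewrite mcoeff_mpoly.
Qed.

Definition order_ge d p := forall a, (mdeg a < d)%N -> p@_a = 0.

Lemma order_geM d e p q : order_ge d p -> order_ge e q -> order_ge (d + e) (p * q).
Proof.
move=> dp eq a ad; rewrite mcoeffM big1 // => k /eqP ak.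
have [k1d|k1d] := ltnP (mdeg k.1) d; first by rewrite dp ?mul0r.
rewrite [q@__]eq ?mulr0 //; have := congr1 mdeg ak; rewrite mdegD => akE.
by rewrite -(ltn_add2l (mdeg k.1)) -akE (leq_trans ad) // leq_add2r.
Qed.

Lemma order_ge0 p : order_ge 0 p.
Proof. by []. Qed.

Lemma order_ge_sum (I : Type) (r : seq I) (P : pred I) d (p_ : I -> _) :
  (forall i, P i -> order_ge d (p_ i)) -> order_ge d (\sum_(i <- r | P i) p_ i).
Proof.
move=> dp a ad; rewrite raddf_sum big1 // => i Pi; exact: dp.
Qed.

Lemma order_ge_exp f k : order_ge 1 f -> order_ge k (f ^+ k).
Proof.
move=> f1; elim: k => [|k IH]; first exact: order_ge0.
by rewrite exprS -add1n; exact: order_geM.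
Qed.

(** The inverse of [1 - f] is the geometric series, of which each coefficient
    is already that of a partial sum. *)
Lemma mseries_unit_1sub f :
  order_ge 1 f -> mseries_of (1 - f) \is a GRing.unit.
Proof.
move=> f1.
pose g d : {mpoly R[n]} := \sum_(i < d) f ^+ i.
pose G : {mseries R[n]} := MSeries (fun a => (g (mdeg a).+1)@_a).
have gE d a : (mdeg a < d)%N -> (g d)@_a = G a.
  move=> ad; rewrite /g -(subnKC ad) big_split_ord mcoeffD /=.
  rewrite [X in _ + X](@order_ge_sum _ _ _ (mdeg a).+1) ?addr0 // => i _ b bd.
  by apply: (order_ge_exp f1); rewrite (leq_trans bd) // leq_addr.
apply/unitrPr; exists G; apply: mseriesP => a.
rewrite (@eq_mseries_mul _ (mseries_of (1 - f)) G (mseries_of (g (mdeg a).+1))) //.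
  rewrite -mseries_ofM /= /g.
  rewrite -[1 - f]opprB mulNr -subrX1 opprB mcoeffB.
  by rewrite [X in _ - X](order_ge_exp f1) ?subr0.
by move=> b ba; apply/esym/gE.
Qed.

(** The geometric series of several variables: the coefficient of a monomial
    in the product of the [1 / (1 - t_i X_i)] is its value at [t]. *)
Lemma mseries_geometric (t : 'I_n -> R) :
  MSeries (fun a => \prod_(i < n) t i ^+ a i)
  * mseries_of (\prod_(i < n) (1 - t i *: 'X_i)) = 1.
Proof.
pose G (s : seq 'I_n) : {mseries R[n]} := MSeries (fun a =>
  \prod_(i < n) (if i \in s then t i ^+ a i else (a i == 0)%:R)).
have GE s : uniq s -> G s * mseries_of (\prod_(i <- s) (1 - t i *: 'X_i)) = 1.
  elim: s => [_|x s IH /= /andP[xs us]].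
    rewrite big_nil mulr1; apply: mseriesP => a /=.
    rewrite mcoeff1; case: eqP => [->|/mnmP/eqfunP].
      by rewrite big1 // => i _; rewrite mnm0E eqxx.
    case/forallPn => i; rewrite mnm0E => /negPf ai.
    by rewrite (bigD1 i) //= ai mul0r.
  rewrite big_cons mseries_ofM mulrA -[RHS](IH us); congr (_ * _).
  rewrite mulrC mseries_ofB mulrBl mul1r -mul_mpolyC mseries_ofM -mulrA.
  apply: mseriesP => a; rewrite mseries_addE.
  rewrite -[(- _ : {mseries R[n]}) a]/(- (_ a)) mseries_mulCX mseries_mulX /=.
  have xx : x \in x :: s by exact: mem_head.
  rewrite (bigD1 x) // xx [in RHS](bigD1 x) // (negPf xs).
  have eqr i : i != x -> (i \in x :: s) = (i \in s) by rewrite in_cons => /negPf->.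
  case: ifP => ax; last first.
    have ->: a x = 0%N by lia.
    rewrite mulr0 subr0 expr0 eqxx; congr (_ * _).
    by apply: eq_bigr => i ix; rewrite eqr.
  rewrite [X in _ * X](bigD1 x) // xx mnmBE mnm1E eqxx subn1.
  rewrite mulrA -exprS prednK // -mulrBr.
  rewrite [X in _ * X](_ : _ = 0); last first.
    apply/eqP; rewrite subr_eq0; apply/eqP/eq_bigr => i ix.
    by rewrite mnmBE mnm1E [x == i]eq_sym (negPf ix) subn0.
  by rewrite mulr0; rewrite -[a x == _]negbK -lt0n ax /= mul0r.
have := GE (enum 'I_n) (enum_uniq _); rewrite big_enum /= => <-.
congr (_ * _); apply: mseriesP => a /=; apply: eq_bigr => i _.
by rewrite mem_enum.
Qed.

End SeriesArithmetic.

(** * Complete functions and elementary polynomials *)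

Section CompleteFunctions.
Variable T : comNzRingType.
Implicit Types (A C : seq T) (a : T) (d j : int).

Lemma Scomplete_lt0 A j : (j < 0)%R -> Scomplete A j = 0.
Proof. by case: j. Qed.

Lemma Scomplete_nil j : Scomplete [::] j = (j == 0)%:R :> T.
Proof.
case: j => // d; rewrite /Scomplete big_nil /= mcoeff1.
by rewrite -mdeg_eq0 mdegMn mdeg1 mul1n.
Qed.

Lemma perm_Scomplete A C j : perm_eq A C -> Scomplete A j = Scomplete C j.
Proof. by case: j => // d eqAC; rewrite /Scomplete (perm_big _ eqAC). Qed.

(** Multiplying the generating series of [a :: A] by [1 - a X] gives that of
    [A]. *)
Lemma Scomplete_cons a A j :
  Scomplete (a :: A) j = Scomplete A j + a * Scomplete (a :: A) (j - 1).
Proof.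
case: j => [d|d]; last by rewrite /= mulr0 addr0.
pose G C : {mseries T[1]} :=
  \prod_(c <- C) (mseries_of (1 - c *: 'X_ord0))^-1.
have unit_a : mseries_of (1 - a *: 'X_ord0 : {mpoly T[1]}) \is a GRing.unit.
  apply: mseries_unit_1sub => b; rewrite ltnS leqn0 mdeg_eq0 => /eqP->.
  by rewrite mcoeffZ mcoeffX mnm1_eq0 mulr0.
have GA : G A = mseries_of (1 - a *: 'X_ord0) * G (a :: A).
  by rewrite /G big_cons mulVKr.
have /(congr1 (fun F : {mseries T[1]} => F (U_(ord0) *+ d)%MM)) := GA.
rewrite mseries_ofB mulrBl mul1r -mul_mpolyC mseries_ofM -mulrA.
rewrite mseries_addE -[(- _ : {mseries T[1]}) _]/(- (_ _)).
rewrite mseries_mulCX mseries_mulX mulmnE mnm1E eqxx mul1n => /eqP.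
rewrite eq_sym subr_eq => /eqP eG.
rewrite {1}/Scomplete [LHS]eG; congr (_ + a * _).
case: d {eG} => [|d] //=; rewrite subn1 /=.
by rewrite mulmS addmC addmK.
Qed.

Definition esym_poly A : {poly T} := \prod_(a <- A) (1 - a *: 'X).

Lemma esym_poly_cons a A : esym_poly (a :: A) = (1 - a *: 'X) * esym_poly A.
Proof. by rewrite /esym_poly big_cons. Qed.

Lemma coef_esym_poly_cons a A i : (esym_poly (a :: A))`_i =
  (esym_poly A)`_i - a * (if i is i'.+1 then (esym_poly A)`_i' else 0).
Proof.
rewrite esym_poly_cons mulrBl mul1r coefB -scalerAl coefZ coefXM.
by case: i.
Qed.

Lemma size_esym_poly A : (size (esym_poly A) <= (size A).+1)%N.
Proof.
elim: A => [|a A IH]; first by rewrite /esym_poly big_nil size_poly1.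
apply/leq_sizeP => j Aj; rewrite coef_esym_poly_cons.
case: j Aj => // j Aj; rewrite !(leq_sizeP _ _ IH) ?mulr0 ?subr0 //.
exact: ltnW.
Qed.

Lemma horner_esym_poly A c : (esym_poly A).[c] = \prod_(a <- A) (1 - a * c).
Proof.
by rewrite horner_prod; apply: eq_bigr => a _; rewrite !hornerE.
Qed.

(** Multiplication of generating series: removing from an alphabet the letters
    of [A] amounts to multiplying by [esym_poly A]. *)
Lemma esym_poly_Scomplete A C d (N : nat) : (size A < N)%N ->
  \sum_(i < N) (esym_poly A)`_i * Scomplete (A ++ C) (d - i%:Z)
  = Scomplete C d.
Proof.
elim: A N => [|a A IH] [//|N] AN.
  rewrite big_ord_recl /esym_poly big_nil coef1 mul1r subr0 big1 ?addr0 //=.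
  by move=> i _; rewrite coef1 mul0r.
rewrite -[RHS](IH N.+1) 1?ltnW //=.
under eq_bigr do rewrite coef_esym_poly_cons mulrBl.
rewrite sumrB [X in _ - X]big_ord_recl mulr0 mul0r add0r.
rewrite [in RHS]big_ord_recr /= (leq_sizeP _ _ (size_esym_poly A)) // mul0r addr0.
rewrite big_ord_recr /= (leq_sizeP _ _ (size_esym_poly A)) // mul0r addr0.
rewrite -sumrB; apply: eq_bigr => i _.
have ->: d - (bump 0 i)%:Z = d - i%:Z - 1 by rewrite /bump /=; lia.
by rewrite [Scomplete _ (d - i%:Z)]Scomplete_cons mulrDr mulrCA mulrA addrK.
Qed.

Lemma esym_poly_inv A d (N : nat) : (size A < N)%N ->
  \sum_(i < N) (esym_poly A)`_i * Scomplete A (d - i%:Z) = (d == 0)%:R.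
Proof.
by move=> AN; rewrite -Scomplete_nil -(esym_poly_Scomplete [::] d AN) cats0.
Qed.

Lemma esym_poly_inv_le A d (t : nat) : (d <= t%:Z)%R ->
  \sum_(i < t.+1) (esym_poly A)`_i * Scomplete A (d - i%:Z) = (d == 0)%:R.
Proof.
move=> dt; rewrite -(@esym_poly_inv A _ (t.+1 + size A)) ?ltnS ?leq_addl //.
rewrite big_split_ord /= [X in _ = _ + X]big1 ?addr0 // => i _.
by rewrite Scomplete_lt0 ?mulr0 //=; lia.
Qed.

Lemma Scomplete0 A : Scomplete A 0 = 1.
Proof.
by elim: A => [|a A IH]; rewrite ?Scomplete_nil // Scomplete_cons IH mulr0 addr0.
Qed.

Lemma esym_poly0 A : (esym_poly A)`_0 = 1.
Proof.
elim: A => [|a A IH]; first by rewrite /esym_poly big_nil coef1.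
by rewrite coef_esym_poly_cons IH mulr0 subr0.
Qed.

Lemma Scomplete_seq1 x k : Scomplete [:: x] (Posz k) = x ^+ k :> T.
Proof.
elim: k => [|k IH]; first by rewrite Scomplete0.
by rewrite Scomplete_cons Scomplete_nil add0r exprS -IH -[k.+1]addn1 PoszD addrK.
Qed.

End CompleteFunctions.

Lemma rmorph_Scomplete (T U : comNzRingType) (f : {rmorphism T -> U}) A j :
  f (Scomplete A j) = Scomplete (map f A) j.
Proof.
case: j => [d|d]; last by rewrite /= rmorph0.
elim: A d => [|a A IH] d.
  by rewrite !Scomplete_nil rmorph_nat.
elim: d => [|d IHd]; first by rewrite !Scomplete0 rmorph1.
rewrite map_cons Scomplete_cons [RHS]Scomplete_cons rmorphD rmorphM IH.
have ->: Posz d.+1 - 1 = d by lia.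
by rewrite -map_cons IHd.
Qed.

(** * The dual Jacobi-Trudi identity *)

(** Complementary minors of inverse matrices: multiply [A] by [B] with its first
    block of columns replaced by that of the identity. *)
Lemma det_complementary_minor (T : comNzRingType) (r c : nat)
    (A B : 'M[T]_(r + c)) :
  A *m B = 1%:M -> \det (ulsubmx A) = \det A * \det (drsubmx B).
Proof.
move=> AB1.
have -> : \det (drsubmx B) = \det (block_mx 1%:M (ursubmx B) 0 (drsubmx B)).
  by rewrite det_ublock det1 mul1r.
rewrite -det_mulmx; have : A *m block_mx 1%:M (ursubmx B) 0 (drsubmx B)
  = block_mx (ulsubmx A) 0 (dlsubmx A) 1%:M.
  move: AB1; rewrite -{1 2}[A]submxK -{1}[B]submxK !mulmx_block scalar_mx_block.
  case/eq_block_mx => _ -> _ ->; by rewrite !mulmx1 !mulmx0 !addr0.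
by move=> ->; rewrite det_lblock det1 mulr1.
Qed.

(** Compare the Vandermonde determinants of [s 0, s 1, ...] and of
    [0, 1, ...]. *)
Lemma sign_perm_inversions (N : nat) (s : 'S_N) :
  (-1) ^+ s = \prod_(i < N) \prod_(j < N | (i < j)%N)
                 Num.sg ((s j)%:Z - (s i)%:Z) :> int.
Proof.
pose a (t : 'S_N) : 'rV[int]_N := \row_j (t j)%:Z.
have detE : \det (Vandermonde N (a s)) = (-1) ^+ s * \det (Vandermonde N (a 1%g)).
  rewrite mulrC -odd_permV -det_perm -det_mulmx -col_permE.
  congr (\det _); apply/matrixP => i j.
  by rewrite !mxE perm1.
have sg_prod (F : 'I_N -> 'I_N -> int) :
    Num.sg (\prod_(i < N) \prod_(j < N | (i < j)%N) F i j)
    = \prod_(i < N) \prod_(j < N | (i < j)%N) Num.sg (F i j).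
  rewrite (big_morph _ (@sgrM _) (@sgr1 _)); apply: eq_bigr => i _.
  by rewrite (big_morph _ (@sgrM _) (@sgr1 _)).
move: detE => /(congr1 Num.sg); rewrite !det_Vandermonde sgrM !sg_prod.
rewrite [X in _ = _ * X]big1 => [|i _]; last first.
  rewrite big1 // => j ij; apply: gtr0_sg.
  by rewrite !mxE !perm1 subr_gt0 ltz_nat.
rewrite mulr1 sgrX sgrN1 => <-.
by apply: eq_bigr => i _; apply: eq_bigr => j _; rewrite !mxE.
Qed.

Section DualJacobiTrudi.
Variable T : comNzRingType.
Implicit Types (A : seq T) (mu : seq nat).

(** Elementary functions with the sign [(-1)^d], and zero for negative [d]. *)
Definition esigned A (d : int) : T :=
  if d is Posz i then (esym_poly A)`_i else 0.

(** The conjugate partition describes the same diagram by its columns. *)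
Lemma leq_count_nth mu i j : sorted geq mu ->
  (i < count (fun p => (j < p)%N) mu)%N = (j < nth 0%N mu i)%N.
Proof.
elim: mu i => [|p mu IH] i; first by rewrite nth_nil.
rewrite /= (path_sortedE (rev_trans leq_trans)) => /andP[pmu smu].
have [jp|pj] := ltnP j p; first by case: i => [|i]; rewrite ?jp //= add1n ltnS IH.
have /eqP-> : count (fun q => (j < q)%N) mu == 0%N.
  rewrite -leqn0 leqNgt -has_count; apply/hasPn => q qmu.
  by rewrite -leqNgt (leq_trans _ pj) //; move/allP: pmu; apply.
case: i => [|i] /=; first by rewrite add0n [RHS]ltnNge pj.
rewrite add0n ltn0; apply/esym/negbTE; rewrite -leqNgt.
have [imu|imu] := ltnP i (size mu); last by rewrite nth_default.
by rewrite (leq_trans _ pj) //; move/allP: pmu; apply; exact: mem_nth.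
Qed.

Section Maya.
Variables (mu : seq nat) (r c : nat).
Hypotheses (mu_sorted : sorted geq mu) (size_mu : size mu = r).
Hypothesis mu_c : (head 0%N mu <= c)%N.
Let nu j := count (fun p => (j < p)%N) mu.

Lemma nth_le_head i : (nth 0 mu i <= c)%N.
Proof.
rewrite leqNgt -leq_count_nth // -leqNgt.
suff -> : count (fun p => (c < p)%N) mu = 0%N by [].
apply/eqP; rewrite -leqn0 leqNgt leq_count_nth // nth0 -leqNgt //.
Qed.

(** The rows of [mu] occupy the positions [mu_i + r - 1 - i] and its columns
    the remaining ones of [0, ..., r + c - 1]: these are the vertical and the
    horizontal steps of the boundary path of the diagram. *)
Definition maya_nat (a : 'I_(r + c)) : nat :=
  match fintype.split a with
  | inl i => nth 0 mu i + (r.-1 - i)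
  | inr j => r + j - nu j
  end.

Lemma maya_lshift (i : 'I_r) : maya_nat (lshift c i) = (nth 0 mu i + (r.-1 - i))%N.
Proof. by rewrite /maya_nat (unsplitK (inl i)). Qed.
Lemma maya_rshift (j : 'I_c) : maya_nat (rshift r j) = (r + j - nu j)%N.
Proof. by rewrite /maya_nat (unsplitK (inr j)). Qed.

Lemma conj_le_size j : (nu j <= r)%N.
Proof. by rewrite -size_mu; exact: count_size. Qed.

Lemma maya_lt a : (maya_nat a < r + c)%N.
Proof.
case: (split_ordP a) => [i|j] ->; rewrite ?maya_lshift ?maya_rshift.
  by have := nth_le_head i; have := ltn_ord i; lia.
by have := ltn_ord j; have := conj_le_size j; lia.
Qed.

Lemma nth_mono i i' : (i <= i')%N -> (nth 0 mu i' <= nth 0 mu i)%N.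
Proof.
move=> ii'; rewrite leqNgt -leq_count_nth // -leqNgt.
by rewrite (leq_trans _ ii') // leqNgt leq_count_nth // ltnn.
Qed.

Lemma conj_mono j j' : (j <= j')%N -> (nu j' <= nu j)%N.
Proof. by move=> jj'; apply: sub_count => p /=; exact: leq_ltn_trans. Qed.

Lemma maya_rows (i i' : 'I_r) : (i < i')%N ->
  (maya_nat (lshift c i') < maya_nat (lshift c i))%N.
Proof.
move=> ii'; rewrite !maya_lshift; have := nth_mono (ltnW ii').
by have := ltn_ord i'; lia.
Qed.

Lemma maya_columns (j j' : 'I_c) : (j < j')%N ->
  (maya_nat (rshift r j) < maya_nat (rshift r j'))%N.
Proof.
move=> jj'; rewrite !maya_rshift; have := conj_mono (ltnW jj').
by have := conj_le_size j; lia.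
Qed.

(** The order of a row and a column position tells whether their common box is
    in the diagram, so that the boxes are the inversions counted by the sign. *)
Lemma maya_box (i : 'I_r) (j : 'I_c) :
  if (j < nth 0 mu i)%N
  then (maya_nat (rshift r j) < maya_nat (lshift c i))%N
  else (maya_nat (lshift c i) < maya_nat (rshift r j))%N.
Proof.
rewrite maya_lshift maya_rshift; have := leq_count_nth i j mu_sorted.
rewrite -/(nu j); case: ifP => jmu; have := ltn_ord i; have := conj_le_size j; lia.
Qed.

Lemma maya_inj : injective (fun a => Ordinal (maya_lt a)).
Proof.
move=> a b [] ab; apply/eqP; apply/negPn/negP => /eqP.
move: ab; case: (split_ordP a) => [i|j] ->; case: (split_ordP b) => [i'|j'] ->.
- case: (ltngtP i i') => [/maya_rows|/maya_rows|/val_inj->//]; lia.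
- by have := maya_box i j'; case: ifP => _; lia.
- by have := maya_box i' j; case: ifP => _; lia.
case: (ltngtP j j') => [/maya_columns|/maya_columns|/val_inj->//]; lia.
Qed.

Definition maya : 'S_(r + c) := perm maya_inj.

Lemma mayaE a : maya a = maya_nat a :> nat.
Proof. by rewrite permE. Qed.

(** The last factor depends on [r] only, and disappears when two partitions are
    compared. *)
Lemma sign_maya : (-1) ^+ maya = (-1) ^+ sumn mu
  * \prod_(i < r) \prod_(i' < r) (if (i < i')%N then -1 else 1) :> int.
Proof.
rewrite sign_perm_inversions big_split_ord /=.
rewrite [X in _ * X]big1 ?mulr1; last first.
  move=> j _; rewrite big_mkcond big_split_ord /= !big1 ?mulr1 // => [j'|i] _.
    case: ifP => //; rewrite ltn_add2l !mayaE => /maya_columns jj'.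
    by apply: gtr0_sg; rewrite subr_gt0 ltz_nat.
  by case: ifP => //; have := ltn_ord i; lia.
have -> : (-1) ^+ sumn mu = \prod_(i < r) (-1) ^+ nth 0%N mu i :> int.
  rewrite prodrXr; congr (_ ^+ _); rewrite sumnE (big_nth 0%N).
  by rewrite big_mkord size_mu.
rewrite -big_split; apply: eq_bigr => i _ /=.
rewrite big_mkcond big_split_ord [RHS]mulrC; congr (_ * _) => /=; last first.
  transitivity (\prod_(j < c) (if (j < nth 0 mu i)%N then -1 else 1 : int)).
    apply: eq_bigr => j _; rewrite ifT; last by have := ltn_ord i; lia.
    rewrite !mayaE; have := maya_box i j; case: ifP => _ lt.
      by apply: ltr0_sg; rewrite subr_lt0 ltz_nat.
    by apply: gtr0_sg; rewrite subr_gt0 ltz_nat.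
  rewrite -big_mkcond -(big_ord_widen _ (fun=> -1 : int)) ?nth_le_head //.
  by rewrite prodr_const card_ord.
apply: eq_bigr => i' _; case: ifP => // /maya_rows lt; rewrite !mayaE.
by apply: ltr0_sg; rewrite subr_lt0 ltz_nat.
Qed.

End Maya.

Lemma schurSE A (k : nat) (v : seq int) : size v = k ->
  schurS A v = \det (\matrix_(i < k, j < k) Scomplete A (v`_i - i%:Z + j%:Z)).
Proof. by move=> <-. Qed.

Definition esigned_mx A N : 'M[T]_N := \matrix_(a, b) esigned A (a%:Z - b%:Z).
Definition Scomplete_mx A N : 'M[T]_N :=
  \matrix_(a, b) Scomplete A (a%:Z - b%:Z).

Lemma esigned_mxK A N : esigned_mx A N *m Scomplete_mx A N = 1%:M.
Proof.
apply/matrixP => a c; rewrite !mxE.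
transitivity (\sum_(b < a.+1) esigned A (a%:Z - b%:Z) * Scomplete A (b%:Z - c%:Z)).
  rewrite (big_ord_widen N (fun b : nat => esigned A (a%:Z - b%:Z)
             * Scomplete A (b%:Z - c%:Z))) // [RHS]big_mkcond.
  apply: eq_bigr => b _; rewrite !mxE ltnS; case: ifP => // ba.
  have : (a%:Z - b%:Z < 0)%R by lia.
  by case: (_ - _) => // k _; rewrite mul0r.
rewrite (reindex_inj rev_ord_inj) /=.
have -> : (a == c)%:R = (a%:Z - c%:Z == 0)%:R :> T.
  by congr (nat_of_bool _)%:R; rewrite subr_eq0.
rewrite -(@esym_poly_inv_le _ A _ a); last by lia.
apply: eq_bigr => i _; have := ltn_ord i; rewrite ltnS subSS => ia.
have -> : a%:Z - (a - i)%:Z = i by lia.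
by congr (_ * Scomplete _ _); lia.
Qed.

Lemma det_esigned_mx A N : \det (esigned_mx A N) = 1.
Proof.
rewrite det_trig.
  by rewrite big1 // => i _; rewrite mxE subrr /= esym_poly0.
apply/is_trig_mxP => i j ij; rewrite mxE.
by have : (i%:Z - j%:Z < 0)%R; [rewrite subr_lt0 ltz_nat | case: (_ - _)].
Qed.

(** The dual Jacobi-Trudi identity: both determinants are complementary minors
    of the two inverse Toeplitz matrices, up to the sign of the permutations
    that select their rows and columns. *)
Theorem dual_jacobi_trudi A mu : sorted geq mu ->
  \det (\matrix_(i < size mu, j < size mu)
          esigned A ((nth 0%N mu i)%:Z - i%:Z + j%:Z))
  = (-1) ^+ sumn mu * schurS A (map Posz (conjugate mu)).
Proof.
move=> mu_sorted; set r := size mu; set c := head 0%N mu.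
(* the rows of the first matrix are selected by [mu], and its columns by the
   zero partition in the same box *)
have mu0_sorted : sorted geq (nseq r 0%N) by case: (r) => //= k; elim: k.
have mu0_c : (head 0%N (nseq r 0%N) <= c)%N by case: (r).
pose s := maya mu_sorted (erefl r) (leqnn c).
pose s0 := maya mu0_sorted (size_nseq r 0%N) mu0_c.
pose U : 'M_(r + c) := mxsub s s0 (esigned_mx A (r + c)).
pose V : 'M_(r + c) := mxsub s0 s (Scomplete_mx A (r + c)).
have UV1 : U *m V = 1%:M.
  apply/matrixP => a b; rewrite !mxE.
  have /matrixP/(_ (s a) (s b)) := esigned_mxK A (r + c).
  rewrite !mxE (inj_eq perm_inj) => <-.
  rewrite [RHS](reindex_inj (@perm_inj _ s0)); apply: eq_bigr => e _.
  by rewrite !mxE.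
have detU : \det U = (-1) ^+ sumn mu.
  have -> : U = row_perm s (col_perm s0 (esigned_mx A (r + c))).
    by apply/matrixP => a b; rewrite !mxE.
  rewrite row_permE col_permE !det_mulmx !det_perm odd_permV det_esigned_mx mul1r.
  have sgn_int (t : 'S_(r + c)) : (-1) ^+ t = ((-1) ^+ t : int)%:~R :> T.
    by rewrite rmorphXn rmorphN1.
  rewrite !sgn_int -rmorphM !sign_maya -mulrA.
  have -> : sumn (nseq r 0%N) = 0%N by elim: (r).
  rewrite expr0 mul1r -big_split big1 => [|i _]; last first.
    by rewrite -big_split big1 // => j _ /=; case: ifP.
  by rewrite mulr1 rmorphXn rmorphN1.
have := det_complementary_minor UV1; rewrite detU => det_minor.
transitivity (\det (ulsubmx U)).
  congr (\det _); apply/matrixP => i j; rewrite !mxE !mayaE !maya_lshift.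
  have -> : nth 0%N (nseq r 0%N) j = 0%N by rewrite nth_nseq if_same.
  by congr (esigned _ _); have := ltn_ord i; have := ltn_ord j; rewrite /r; lia.
rewrite det_minor; congr (_ * _); rewrite -det_tr.
rewrite (@schurSE _ c); last by rewrite size_map size_mkseq.
congr (\det _); apply/matrixP => i j; rewrite !mxE !mayaE !maya_rshift.
rewrite (nth_map 0%N) ?size_mkseq // nth_mkseq //.
have -> : count (fun p => (j < p)%N) (nseq r 0%N) = 0%N by rewrite count_nseq mul0n.
by congr (Scomplete _ _); have := conj_le_size (erefl r) i; lia.
Qed.

End DualJacobiTrudi.

(** * The Cauchy-Binet formula *)

Section CauchyBinet.
Variables (r L : nat).
Implicit Types (f g : {ffun 'I_r -> 'I_L}).

(** Sets of [r] column indices are encoded by their decreasing enumeration,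
    which is what partitions become after adding the staircase. *)
Definition decreasing g :=
  [forall i : 'I_r, forall j : 'I_r, (i < j)%N ==> (g j < g i)%N].

Lemma decreasingP g :
  reflect (forall i j : 'I_r, (i < j)%N -> (g j < g i)%N) (decreasing g).
Proof.
apply: (iffP 'forall_forallP) => gP i j; first by apply/implyP/gP.
exact/implyP/gP.
Qed.

Lemma decreasing_inj g : decreasing g -> injective g.
Proof.
move=> /decreasingP gP i j gij.
by case: (ltngtP i j) => [/gP|/gP|/val_inj //]; rewrite gij ltnn.
Qed.

Lemma decreasing_sorted g :
  decreasing g -> sorted gtn [seq (g i : nat) | i <- enum 'I_r].
Proof.
move=> /decreasingP gP.
have : sorted ltn [seq val i | i <- enum 'I_r].
  by rewrite val_enum_ord iota_ltn_sorted.
rewrite !sorted_map; apply: sub_sorted => i j /=; exact: gP.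
Qed.

Definition reindex_by (gs : {ffun 'I_r -> 'I_L} * 'S_r) : {ffun 'I_r -> 'I_L} :=
  [ffun i => gs.1 (gs.2 i)].

Lemma reindex_by_inj :
  {in [pred gs | decreasing gs.1] &, injective reindex_by}.
Proof.
move=> [g s] [g' s'] /= gP gP' /ffunP gsE.
have eq_g : g = g'.
  have : [seq (g i : nat) | i <- enum 'I_r] = [seq (g' i : nat) | i <- enum 'I_r].
    apply: (irr_sorted_eq (rev_trans ltn_trans) ltnn); try exact: decreasing_sorted.
    move=> p; apply/mapP/mapP => -[i _ ->].
      exists (s' (s^-1 i)%g); rewrite ?mem_enum //.
      by have := gsE (s^-1 i)%g; rewrite !ffunE /= permKV => ->.
    exists (s (s'^-1 i)%g); rewrite ?mem_enum //.
    by have := gsE (s'^-1 i)%g; rewrite !ffunE /= permKV => ->.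
  move=> /eq_in_map eq_g; apply/ffunP => i; apply: val_inj.
  by apply: eq_g; rewrite mem_enum.
congr (_, _) => //; apply/permP => i; apply: (decreasing_inj gP).
by have := gsE i; rewrite !ffunE /= -eq_g.
Qed.

(** The decreasing family is obtained by sorting the values; by
    [reindex_by_inj], it is unique and so is the permutation. *)
Lemma reindex_by_surj f : injective f ->
  exists2 gs, decreasing gs.1 & f = reindex_by gs.
Proof.
move=> f_inj; pose ge (x y : 'I_L) := (y <= x)%N.
pose t := [tuple f i | i < r]; pose u := sort ge t.
have ge_tot : total ge by move=> x y; exact: leq_total.
have ge_trans : transitive ge by move=> y x z xy yz; exact: leq_trans yz xy.
have size_u : size u == r by rewrite size_sort size_tuple.
have t_uniq : uniq t.
  by rewrite map_inj_uniq ?enum_uniq //; exact: f_inj.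
have /tuple_permP[s tE] : perm_eq t (Tuple size_u) by rewrite perm_sym perm_sort.
exists ([ffun i => tnth (Tuple size_u) i], s).
  apply/decreasingP => i j ij; rewrite !ffunE.
  have x0 : 'I_L by exact: tnth (Tuple size_u) i.
  rewrite !(tnth_nth x0) /= ltn_neqAle.
  have -> : (nth x0 u j <= nth x0 u i)%N.
    by apply: (sorted_ltn_nth ge_trans x0 (sort_sorted ge_tot t));
      rewrite // -topredE /= (eqP size_u).
  rewrite andbT val_eqE nth_uniq ?(eqP size_u) ?sort_uniq //.
  by rewrite gtn_eqF.
apply/ffunP => i; rewrite !ffunE /=.
have : tnth t i = tnth [tuple tnth (Tuple size_u) (s i) | i < r] i.
  by congr tnth; exact: val_inj.
by rewrite !tnth_mktuple.
Qed.

(** The Cauchy-Binet formula: expand [\det (A *m B)] along all families [f] of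
    column indices of [A]; those with a repetition contribute a determinant
    with two equal rows, and the others are grouped by their sorted version. *)
Theorem Cauchy_Binet (T : comNzRingType) (A : 'M[T]_(r, L)) (B : 'M[T]_(L, r)) :
  \det (A *m B)
  = \sum_(g | decreasing g) \det (colsub g A) * \det (rowsub g B).
Proof.
transitivity (\sum_(f : {ffun 'I_r -> 'I_L})
    (\prod_i A i (f i)) * \det (rowsub f B)).
  rewrite /determinant.
  under eq_bigr => s _.
    under eq_bigr => i _ do rewrite mxE.
    rewrite bigA_distr_bigA big_distrr /=.
    over.
  rewrite exchange_big; apply: eq_bigr => f _; rewrite big_distrr /=.
  apply: eq_bigr => s _; rewrite big_split mulrCA; congr (_ * (_ * _)).
  by apply: eq_bigr => i _; rewrite mxE.
rewrite (bigID (fun f : {ffun 'I_r -> 'I_L} => injectiveb f)) /=.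
rewrite [X in _ + X]big1 ?addr0; last first.
  move=> f /injectivePn[i [j ij fij]].
  by rewrite (determinant_alternate ij) ?mulr0 // => p; rewrite !mxE fij.
transitivity (\sum_(f in [set reindex_by gs | gs in [pred gs | decreasing gs.1]])
    (\prod_i A i (f i)) * \det (rowsub f B)).
  apply: eq_bigl => f; apply/injectiveP/imsetP => [/reindex_by_surj[gs]|[gs]].
    by exists gs.
  move=> gsP -> i j; rewrite !ffunE => /(decreasing_inj gsP); exact: perm_inj.
rewrite (big_imset _ reindex_by_inj) /=.
transitivity (\sum_(g | decreasing g) \sum_(s : 'S_r)
    (\prod_i A i (reindex_by (g, s) i)) * \det (rowsub (reindex_by (g, s)) B)).
  by rewrite pair_big /=; apply: eq_big => -[g s] //=; rewrite andbT.
apply: eq_bigr => g _; rewrite [in RHS]/determinant big_distrl /=.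
apply: eq_bigr => s _.
have -> : rowsub (reindex_by (g, s)) B = row_perm s (rowsub g B).
  by apply/matrixP => i j; rewrite !mxE ffunE.
rewrite row_permE det_mulmx det_perm mulrA [_ * (-1) ^+ _]mulrC.
by congr (_ * _ * _); apply: eq_bigr => i _; rewrite !mxE ffunE.
Qed.

End CauchyBinet.

(** * Alternants *)

Section FirstRow.
Variables (T : comNzRingType) (N : nat).

Lemma col_mx_ord0 (v : 'rV[T]_N.+1) (B : 'M[T]_(N, N.+1)) p :
  (col_mx v B : 'M_N.+1) ord0 p = v 0 p.
Proof.
have {1}-> : ord0 = lshift N (0 : 'I_1) by exact: val_inj.
exact: col_mxEu.
Qed.

Lemma col_mx_lift (v : 'rV[T]_N.+1) (B : 'M[T]_(N, N.+1)) i p :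
  (col_mx v B : 'M_N.+1) (lift ord0 i) p = B i p.
Proof.
have -> : lift ord0 i = rshift 1 i by exact: val_inj.
exact: col_mxEd.
Qed.

Lemma det_col_mx (v : 'rV[T]_N.+1) (B : 'M[T]_(N, N.+1)) :
  \det (col_mx v B : 'M_N.+1)
  = \sum_p v 0 p * ((-1) ^+ p * \det (col' p B)).
Proof.
rewrite (expand_det_row _ (ord0 : 'I_(1 + N))); apply: eq_bigr => p _.
rewrite col_mx_ord0 /cofactor add0n; congr (_ * (_ * \det _)).
by apply/matrixP => i j; rewrite 2!mxE col_mx_lift [RHS]mxE.
Qed.

Lemma det_col_mx_sum (K : nat) (c : nat -> T) (v : nat -> 'rV[T]_N.+1)
    (B : 'M[T]_(N, N.+1)) :
  \sum_(t < K) c t * \det (col_mx (v t) B : 'M_N.+1)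
  = \det (col_mx (\sum_(t < K) c t *: v t) B : 'M_N.+1).
Proof.
rewrite det_col_mx; under eq_bigr do rewrite det_col_mx big_distrr /=.
rewrite exchange_big; apply: eq_bigr => p _; rewrite summxE big_distrl /=.
by apply: eq_bigr => t _; rewrite mxE mulrA.
Qed.

(** Cauchy-Binet with one more row on top, by expansion along this row. *)
Lemma Cauchy_Binet_first_row (L : nat) (v : 'rV[T]_N.+1) (A : 'M[T]_(N, L))
    (H : 'M[T]_(L, N.+1)) :
  \det (col_mx v (A *m H) : 'M_N.+1)
  = \sum_(g | decreasing g)
      \det (colsub g A) * \det (col_mx v (rowsub g H) : 'M_N.+1).
Proof.
under [RHS]eq_bigr do rewrite det_col_mx big_distrr /=.
rewrite exchange_big det_col_mx; apply: eq_bigr => p _.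
have -> : col' p (A *m H) = A *m col' p H.
  apply/matrixP => i j; rewrite !mxE; apply: eq_bigr => q _; by rewrite !mxE.
rewrite Cauchy_Binet 2!big_distrr; apply: eq_bigr => g _ /=.
have -> : col' p (rowsub g H) = rowsub g (col' p H).
  by apply/matrixP => i j; rewrite !mxE.
by rewrite [RHS]mulrCA; congr (_ * _); rewrite mulrCA.
Qed.

End FirstRow.

Section Alternants.
Variables (T : comNzRingType) (N : nat) (x : 'I_N.+1 -> T).
Let X : seq T := [seq x i | i <- enum 'I_N.+1].

Definition power_row (e : nat) : 'rV[T]_N.+1 := \row_p x p ^+ e.
Definition power_rows : 'M[T]_(N, N.+1) := \matrix_(i, p) x p ^+ (N.-1 - i).
Definition Scomplete_row (e : nat) : 'rV[T]_N.+1 :=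
  \row_j Scomplete X (e%:Z - N%:Z + j%:Z).

Definition esym_others : 'M[T]_N.+1 :=
  \matrix_(j, p) (esym_poly [seq x i | i <- enum 'I_N.+1 & i != p])`_(N - j).

(** Removing from the alphabet all letters but [x p] turns complete functions
    into powers of [x p]. *)
Lemma Scomplete_row_others e : Scomplete_row e *m esym_others = power_row e.
Proof.
apply/rowP => p; rewrite !mxE -Scomplete_seq1.
pose A := [seq x i | i <- enum 'I_N.+1 & i != p].
have size_A : (size A < N.+1)%N.
  have : has (predC (fun i => i != p)) (enum 'I_N.+1).
    by apply/hasP; exists p; rewrite ?mem_enum //= negbK.
  rewrite has_count => count_p; rewrite size_map size_filter.
  have := count_predC (fun i => i != p) (enum 'I_N.+1).
  rewrite size_enum_ord => countE.
  by rewrite (leq_trans _ (eq_leq countE)) // -[X in (X < _)%N]addn0 ltn_add2l.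
rewrite -(esym_poly_Scomplete [:: x p] e size_A).
rewrite (reindex_inj rev_ord_inj); apply: eq_bigr => i _; rewrite !mxE mulrC.
congr (_`_ _ * _); first by have := ltn_ord i; rewrite /=; lia.
rewrite (@perm_Scomplete _ _ (A ++ [:: x p])).
  by congr (Scomplete _ _); have := ltn_ord i; rewrite /=; lia.
rewrite /A -[[:: x p]]/(map x [:: p]) -map_cat; apply: perm_map.
rewrite -(perm_filterC (fun i => i != p)) perm_cat2l.
apply: uniq_perm => [|//|q]; first exact/filter_uniq/enum_uniq.
by rewrite mem_filter mem_enum /= negbK andbT mem_seq1.
Qed.

(** This is the usual Vandermonde matrix up to reversing both rows and columns,
    which leaves the determinant unchanged. *)
Lemma Vandermonde_decreasing :
  \det (col_mx (power_row N) power_rows : 'M_N.+1)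
  = \prod_(i < N.+1) \prod_(j < N.+1 | (i < j)%N) (x i - x j).
Proof.
pose s : 'S_N.+1 := perm rev_ord_inj.
have -> : \det (col_mx (power_row N) power_rows : 'M_N.+1)
  = \det (Vandermonde N.+1 (\row_j x (rev_ord j))).
  have -> : Vandermonde N.+1 (\row_j x (rev_ord j))
      = row_perm s (col_perm s (col_mx (power_row N) power_rows : 'M_N.+1)).
    apply/matrixP => i j; rewrite !mxE !permE.
    have iE : (rev_ord i : nat) = (N - i)%N by rewrite /= subSS.
    case: (split_ordP (rev_ord i : 'I_(1 + N))) => k ki; rewrite mxE.
      have := congr1 val ki; rewrite /= subSS => Ni.
      by congr (_ ^+ _); have := ltn_ord i; have := ltn_ord k; lia.
    have := congr1 val ki; rewrite /= subSS => Ni.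
    by congr (_ ^+ _); have := ltn_ord i; have := ltn_ord k; lia.
  rewrite row_permE col_permE !det_mulmx !det_perm odd_permV mulrCA mulrA.
  by rewrite -mulrA -expr2 sqrr_sign mulr1.
rewrite det_Vandermonde.
rewrite (exchange_big_dep xpredT) //= (reindex_inj rev_ord_inj).
apply: eq_bigr => i _; rewrite (reindex_inj rev_ord_inj).
apply: eq_big => j; first by rewrite /=; have := ltn_ord i; have := ltn_ord j; lia.
by rewrite !mxE !rev_ordK.
Qed.

(** The bialternant formula for a single row: the matrix of complete functions
    is triangular. *)
Lemma alternant_Scomplete_others e :
  \det (col_mx (power_row e) power_rows : 'M_N.+1)
  = Scomplete X (e%:Z - N%:Z) * \det esym_others.
Proof.
pose S0 := \matrix_(i < N, j < N.+1) Scomplete_row (N.-1 - i) 0 j.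
pose S : 'M[T]_N.+1 := col_mx (Scomplete_row e) S0.
have -> : (col_mx (power_row e) power_rows : 'M_N.+1) = S *m esym_others.
  have -> : power_rows = S0 *m esym_others.
    apply/matrixP => i p; have /rowP/(_ p) := Scomplete_row_others (N.-1 - i).
    by rewrite !mxE => <-; apply: eq_bigr => j _; rewrite !mxE.
  by rewrite -Scomplete_row_others -mul_col_mx.
rewrite det_mulmx -[\det S]det_tr; congr (_ * _); rewrite det_trig.
  rewrite big_ord_recl big1 ?mulr1 => [|i _]; rewrite !mxE.
    by case: (split_ordP (ord0 : 'I_(1 + N))) => // k _; rewrite mxE addr0.
  case: (split_ordP (lift ord0 i : 'I_(1 + N))) => k /(congr1 val) /= kE.
    by have := ltn_ord k; rewrite -kE.
  rewrite !mxE -[RHS](Scomplete0 X); congr (Scomplete _ _).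
  have [ik] : i.+1 = k.+1 by exact: kE.
  have lt_kN := ltn_ord k.
  rewrite [X in _ + X](_ : _ = k.+1%:Z); last exact: (congr1 Posz).
  lia.
apply/is_trig_mxP => i j ij; rewrite !mxE.
case: (split_ordP (j : 'I_(1 + N))) => k /(congr1 val) /= kE.
  by have := ltn_ord k; rewrite -kE ltnS leqNgt (leq_ltn_trans (leq0n i) ij).
have jk : j = k.+1 :> nat by exact: kE.
have ik : (i <= k)%N by rewrite -ltnS -jk.
have lt_kN := ltn_ord k; rewrite !mxE Scomplete_lt0 //; lia.
Qed.

Lemma det_esym_others :
  \det esym_others = \prod_(i < N.+1) \prod_(j < N.+1 | (i < j)%N) (x i - x j).
Proof.
by rewrite -Vandermonde_decreasing alternant_Scomplete_others subrr Scomplete0 mul1r.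
Qed.

Lemma alternant_Scomplete e :
  \det (col_mx (power_row e) power_rows : 'M_N.+1)
  = Scomplete X (e%:Z - N%:Z)
    * \prod_(i < N.+1) \prod_(j < N.+1 | (i < j)%N) (x i - x j).
Proof. by rewrite alternant_Scomplete_others det_esym_others. Qed.

End Alternants.

(** * The sum over partitions as a determinant *)

Section SchurSum.
Variables (T : comNzRingType) (N : nat) (x : 'I_N.+1 -> T) (B : seq T).
Let X : seq T := [seq x i | i <- enum 'I_N.+1].
Local Notation L := (N + size B)%N.

(** Row [i] holds the coefficients of [X^(N - 1 - i) Q], so that its product
    with powers of [x p] evaluates this polynomial. *)
Definition esym_coefs : 'M[T]_(N, L) :=
  \matrix_(i, q) ('X^(N.-1 - i) * esym_poly B)`_q.
Definition Scomplete_rows : 'M[T]_(L, N.+1) :=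
  \matrix_(q, j) Scomplete_row x q 0 j.

(** The numerator of the rational form, with [e = N - k].  It is kept for all
    [e], because inverting the factor [esym_poly B] involves larger values. *)
Definition Schur_sum (e : nat) : T :=
  \det (col_mx (Scomplete_row x e) (esym_coefs *m Scomplete_rows) : 'M_N.+1).

Lemma esym_coefs_others :
  esym_coefs *m Scomplete_rows *m esym_others x
  = power_rows x *m diag_mx (\row_p (esym_poly B).[x p]).
Proof.
have -> : esym_coefs *m Scomplete_rows *m esym_others x
    = esym_coefs *m \matrix_(q, p) x p ^+ q.
  rewrite -mulmxA; congr (_ *m _); apply/matrixP => q p.
  have /rowP/(_ p) := Scomplete_row_others x q.
  by rewrite !mxE => <-; apply: eq_bigr => j _; rewrite !mxE.
apply/matrixP => i p; rewrite mul_mx_diag !mxE.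
transitivity (('X^(N.-1 - i) * esym_poly B).[x p]); last by rewrite hornerM hornerXn.
rewrite (@horner_coef_wide _ L); first by apply: eq_bigr => q _; rewrite !mxE.
rewrite (leq_trans (size_polyMleq _ _)) // size_polyXn.
by have := size_esym_poly B; have := ltn_ord i; rewrite /=; lia.
Qed.

Lemma Schur_sum_others e :
  Schur_sum e * \det (esym_others x)
  = \det (col_mx (power_row x e)
      (power_rows x *m diag_mx (\row_p (esym_poly B).[x p])) : 'M_N.+1).
Proof.
rewrite -det_mulmx -esym_coefs_others -Scomplete_row_others; congr (\det _).
by rewrite -mul_col_mx.
Qed.

(** The determinants [Schur_sum e] are multiplied by the Vandermonde determinant
    and evaluated at the letters: a combination of the first rows with the
    coefficients of [P * esym_poly B] makes the values of [esym_poly B] common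
    to all rows, and their product splits off. *)
Lemma Schur_sum_mul (P : {poly T}) (K K' e : nat) :
  (size (P * esym_poly B)%R <= K)%N -> (size P <= K')%N ->
  (\sum_(t < K) (P * esym_poly B)`_t * Schur_sum (e + t)) * \det (esym_others x)
  = (\prod_p (esym_poly B).[x p])
    * (\sum_(t < K') P`_t * Scomplete X ((e + t)%:Z - N%:Z))
    * \det (esym_others x).
Proof.
move=> PQK PK'.
have power_row_sum (R : {poly T}) k : (size R <= k)%N ->
    \sum_(t < k) R`_t *: power_row x (e + t) = \row_p (x p ^+ e * R.[x p]).
  move=> Rk; apply/rowP => p; rewrite summxE mxE (horner_coef_wide _ Rk) big_distrr.
  by apply: eq_bigr => t _; rewrite !mxE exprD mulrCA.
rewrite -mulrA !big_distrl /=.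
under eq_bigr do rewrite -mulrA Schur_sum_others.
under [X in _ = _ * X]eq_bigr do rewrite -mulrA -alternant_Scomplete_others.
rewrite (det_col_mx_sum _ (fun t => (P * esym_poly B)`_t)
  (fun t => power_row x (e + t))).
rewrite (det_col_mx_sum _ (fun t => P`_t) (fun t => power_row x (e + t))).
rewrite !power_row_sum // [RHS]mulrC.
(* every entry of column [p] now carries the factor [(esym_poly B).[x p]] *)
have -> : \prod_p (esym_poly B).[x p] = \det (diag_mx (\row_p (esym_poly B).[x p])).
  by rewrite det_diag; apply: eq_bigr => p _; rewrite mxE.
set V := diag_mx _; rewrite -det_mulmx; congr (\det _).
have -> : \row_p (x p ^+ e * (P * esym_poly B).[x p])
    = (\row_p (x p ^+ e * P.[x p])) *m V.
  by apply/rowP => p; rewrite mul_mx_diag !mxE hornerM mulrA.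
by rewrite -mul_col_mx.
Qed.

End SchurSum.

Section SchurSumPartitions.
Variables (T : comNzRingType) (N : nat) (x : 'I_N.+1 -> T) (B : seq T).
Let X : seq T := [seq x i | i <- enum 'I_N.+1].
Local Notation L := (N + size B)%N.

Definition Schur_term (d : int) (mu : N.-tuple nat) : T :=
  (-1) ^+ sumn mu * schurS B (map Posz (conjugate mu))
                  * schurS X (d :: map Posz mu).

(** Partitions correspond to decreasing families of row indices by subtracting
    the staircase. *)
Definition partition_of (g : {ffun 'I_N -> 'I_L}) : N.-tuple nat :=
  [tuple (g i - (N.-1 - i))%N | i < N].

Lemma nth_partition_of g (i : 'I_N) :
  nth 0%N (partition_of g) i = (g i - (N.-1 - i))%N.
Proof. by rewrite -tnth_nth tnth_mktuple. Qed.

Lemma decreasing_ge (g : {ffun 'I_N -> 'I_L}) (i : 'I_N) :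
  decreasing g -> (N.-1 - i <= g i)%N.
Proof.
move=> /decreasingP gP; move: {2}(N.-1 - i)%N (erefl (N.-1 - i)%N) => d.
elim: d i => [|d IH] i di; first by rewrite di.
have i1N : (i.+1 < N)%N by have := ltn_ord i; lia.
have := gP i (Ordinal i1N) (ltnSn i); have /= := IH (Ordinal i1N).
by rewrite /= (_ : N.-1 - i.+1 = d)%N; [move=> /(_ erefl); lia | lia].
Qed.

Lemma partition_ofP g : decreasing g -> partitions (partition_of g).
Proof.
move=> gD; apply/(sortedP 0%N) => i; rewrite size_tuple => i1N.
have iN : (i < N)%N by exact: ltnW.
have := nth_partition_of g (Ordinal i1N) => /= ->.
have := nth_partition_of g (Ordinal iN) => /= ->.
have := decreasing_ge (Ordinal i1N) gD.
have /(_ (Ordinal iN) (Ordinal i1N) (ltnSn i)) := elimT (decreasingP g) gD.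
by rewrite /=; lia.
Qed.

Lemma partition_of_inj : {in [pred g | decreasing g] &, injective partition_of}.
Proof.
move=> g g' gD gD' eq_part; apply/ffunP => i; apply: val_inj => /=.
have := decreasing_ge i gD; have := decreasing_ge i gD'.
have := nth_partition_of g i; rewrite eq_part nth_partition_of; lia.
Qed.

Lemma partition_of_surj (mu : N.-tuple nat) :
  partitions mu -> (head 0%N mu <= size B)%N ->
  exists2 g, decreasing g & mu = partition_of g.
Proof.
move=> mu_sorted mu_B.
have muE i j : (i <= j)%N -> (nth 0%N mu j <= nth 0%N mu i)%N.
  exact: nth_mono.
have mu_le i : (nth 0%N mu i <= size B)%N by exact: nth_le_head.
have lt_L (i : 'I_N) : (nth 0%N mu i + (N.-1 - i) < L)%N.
  by have := mu_le i; have := ltn_ord i; lia.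
exists [ffun i => Ordinal (lt_L i)].
  apply/decreasingP => i j ij; rewrite !ffunE /=.
  by have := muE _ _ (ltnW ij); have := ltn_ord j; lia.
apply/eq_from_tnth => i; rewrite tnth_mktuple ffunE /= (tnth_nth 0%N); lia.
Qed.

(** The dual Jacobi-Trudi determinant has a zero first row as soon as [mu_1]
    exceeds the degree of [esym_poly B]. *)
Lemma Schur_term_eq0 d (mu : N.-tuple nat) :
  partitions mu -> (size B < head 0%N mu)%N -> Schur_term d mu = 0.
Proof.
move=> mu_sorted mu_B; rewrite /Schur_term -dual_jacobi_trudi //.
have mu_gt0 : (0 < size mu)%N by case: (tval mu) mu_B.
rewrite (expand_det_row _ (Ordinal mu_gt0)) big1 ?mul0r // => j _.
rewrite mxE subr0 nth0 /= (leq_sizeP _ _ (size_esym_poly B)) ?mul0r //.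
by rewrite (leq_trans mu_B) // leq_addr.
Qed.

(** A term of the Cauchy-Binet sum is a dual Jacobi-Trudi determinant in [B]
    times a Jacobi-Trudi determinant in [X]. *)
Lemma Schur_termE e (g : {ffun 'I_N -> 'I_L}) : decreasing g ->
  \det (colsub g (esym_coefs N B))
    * \det (col_mx (Scomplete_row x e) (rowsub g (Scomplete_rows x B)) : 'M_N.+1)
  = Schur_term (e%:Z - N%:Z) (partition_of g).
Proof.
move=> gD; have mu_sorted := partition_ofP gD.
have ge_g i := decreasing_ge i gD.
rewrite /Schur_term -dual_jacobi_trudi //; congr (_ * _).
  rewrite -det_tr size_tuple; congr (\det _); apply/matrixP => i j; rewrite !mxE.
  rewrite nth_partition_of coefXnM; have := ge_g i; have := ltn_ord j => jN.
  case: ltnP => [lt_g | le_g] ge_gi.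
    have : ((g i - (N.-1 - i))%N%:Z - i%:Z + j%:Z < 0)%R.
      by have := ltn_ord i; lia.
    by case: (_ + _).
  have -> : (g i - (N.-1 - i))%N%:Z - i%:Z + j%:Z = (g i - (N.-1 - j))%N%:Z.
    by have := ltn_ord i; lia.
  by [].
rewrite (@schurSE _ _ N.+1); last first.
  exact: (congr1 S (size_tuple (map_tuple Posz (partition_of g)))).
congr (\det _); apply/matrixP => i j; rewrite !mxE.
case: (split_ordP (i : 'I_(1 + N))) => k /(congr1 val) /= kE; rewrite !mxE.
  have -> : (i : nat) = 0%N by rewrite kE; case: k {kE} => -[].
  by rewrite /= subr0.
have ik : (i : nat) = k.+1 by exact: kE.
rewrite ik -[_`_k.+1]/(nth 0 (map Posz (partition_of g)) k).
rewrite (nth_map 0%N) ?size_tuple // nth_partition_of.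
by congr (Scomplete _ _); have := ge_g k; have := ltn_ord k; lia.
Qed.

Lemma Schur_sum_decreasing e : Schur_sum x B e
  = \sum_(g | decreasing g) Schur_term (e%:Z - N%:Z) (partition_of g).
Proof.
rewrite /Schur_sum Cauchy_Binet_first_row.
by apply: eq_bigr => g; exact: Schur_termE.
Qed.

Lemma Schur_term_support d :
  ([set mu | partitions mu /\ Schur_term d mu != 0]
   `<=` [set` [seq partition_of g | g <- enum [pred g | decreasing g]]])%classic.
Proof.
move=> mu [mu_sorted]; have [/(Schur_term_eq0 d mu_sorted)->|mu_B _] :=
  ltnP (size B) (head 0%N mu); first by rewrite eqxx.
have [g gD ->] := partition_of_surj mu_sorted mu_B.
by rewrite /= map_f // mem_enum.
Qed.

Lemma finite_Schur_term d :
  finite_set [set mu | partitions mu /\ Schur_term d mu != 0].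
Proof. exact: sub_finite_set (@Schur_term_support d) (finite_seq _). Qed.

Lemma Schur_sum_partitions e : Schur_sum x B e
  = \sum_(mu \in @partitions N) Schur_term (e%:Z - N%:Z) mu.
Proof.
rewrite (fsbigE [seq partition_of g | g <- enum [pred g | decreasing g]]).
- rewrite big_map big_enum_cond Schur_sum_decreasing; apply: eq_bigl => g.
  rewrite -[g \in _]/(decreasing g).
  have [gD|//] := boolP (decreasing g).
  by apply/esym/mem_set; exact: partition_ofP.
- rewrite map_inj_in_uniq ?enum_uniq // => g g'; rewrite !mem_enum.
  exact: partition_of_inj.
- by move=> mu /= /mapP[g]; rewrite mem_enum => gD ->; exact: partition_ofP.
move=> mu mu_sorted; apply: contraNeq => mu0.
exact: (@Schur_term_support (e%:Z - N%:Z)).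
Qed.

End SchurSumPartitions.

(** * Monomials of products of complete functions *)

Section MonomialExpansion.
Variable R : comNzRingType.

Definition mnm_off N (s : seq 'I_N) (a : 'X_{1..N}) : 'X_{1..N} :=
  [multinom if i \in s then 0%N else a i | i < N].

(** A complete function is the sum of all monomials of its degree, so each
    monomial of the product arises once, from the factorisation that separates
    the variables of [s] from the others. *)
Lemma mcoeff_mul_Scomplete N (P : {mpoly R[N]}) (s : seq 'I_N) (d : nat)
    (a : 'X_{1..N}) :
    uniq s -> (forall (b : 'X_{1..N}) i, i \in s -> (0 < b i)%N -> P@_b = 0) ->
  (P * Scomplete [seq 'X_i | i <- s] d)@_a
  = if (\sum_(i <- s) a i)%N == d then P@_(mnm_off s a) else 0.
Proof.
elim: s d a => [|x s IHs] d a.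
  move=> _ _; rewrite Scomplete_nil big_nil eq_sym.
  have -> : mnm_off [::] a = a by apply/mnmP => i; rewrite mnmE.
  by case: d => [|d] /=; rewrite ?mulr1 ?mulr0 ?mcoeff0.
rewrite cons_uniq => /andP[xs us] Ps.
have xP (b : 'X_{1..N}) : (0 < b x)%N -> P@_b = 0.
  by apply: Ps; rewrite in_cons eqxx.
have {}IHs e b := IHs e b us (fun c i is_ => Ps c i (mem_behead (s := x :: s) is_)).
have off0 (b : 'X_{1..N}) : b x = 0%N -> mnm_off (x :: s) b = mnm_off s b.
  move=> bx; apply/mnmP => i; rewrite !mnmE in_cons.
  by case: eqP => //= ->; rewrite bx if_same.
have offP (b : 'X_{1..N}) : (0 < b x)%N -> P@_(mnm_off s b) = 0.
  by move=> bx; apply: xP; rewrite mnmE (negPf xs).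
elim: d a => [|d IHd] a.
  rewrite Scomplete0 -(Scomplete0 [seq 'X_i | i <- s]) IHs big_cons addn_eq0.
  case: (posnP (a x)) => [ax|ax]; first by rewrite off0 // ax.
  by rewrite offP // if_same.
rewrite map_cons Scomplete_cons mulrDr mcoeffD IHs mulrCA.
rewrite -[_ :: _]/[seq 'X_i | i <- x :: s].
have -> : (d.+1 : int) - 1 = d by lia.
rewrite mcoeff_mulX big_cons; case: (posnP (a x)) => [ax|ax].
  by rewrite addr0 ax off0.
rewrite offP // if_same add0r IHd big_cons mnmBE mnm1E eqxx.
have -> : mnm_off (x :: s) (a - U_(x)) = mnm_off (x :: s) a.
  apply/mnmP => i; rewrite !mnmE in_cons [x == i]eq_sym.
  by case: eqP => //= _; rewrite subn0.
congr (if _ then _ else _).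
rewrite (_ : \sum_(i <- s) (a - U_(x))%MM i = \sum_(i <- s) a i)%N; first by lia.
rewrite big_seq [RHS]big_seq; apply: eq_bigr => i is_.
rewrite mnmBE mnm1E; case: eqP => [xi|_]; last by rewrite subn0.
by move: xs; rewrite xi is_.
Qed.

Variables n m : nat.
Implicit Type a : 'X_{1..n + m}.

Definition degX a := (\sum_(i < n) a (lshift m i))%N.
Definition degY a := (\sum_(j < m) a (rshift n j))%N.

Lemma alphaXE : alphaX R n m = [seq 'X_i | i <- map (lshift m) (enum 'I_n)].
Proof. by rewrite -map_comp. Qed.

Lemma alphaYE : alphaY R n m = [seq 'X_i | i <- map (@rshift n m) (enum 'I_m)].
Proof. by rewrite -map_comp. Qed.

Lemma mcoeff_Scomplete_XY (p : int) (q : nat) a :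
  (Scomplete (alphaX R n m) p * Scomplete (alphaY R n m) q)@_a
  = (((degX a)%:Z == p) && (degY a == q))%:R.
Proof.
case: p => [p|p]; last by rewrite mul0r mcoeff0.
have coefX b : (Scomplete (alphaX R n m) p)@_b
    = ((degX b == p) && [forall j, b (rshift n j) == 0%N])%:R.
  rewrite alphaXE -[Scomplete _ _]mul1r mcoeff_mul_Scomplete; first last.
  - by move=> c i _ ci; rewrite mcoeff1; case: eqP => // c0; rewrite c0 mnm0E in ci.
  - by rewrite map_inj_uniq ?enum_uniq //; exact: lshift_inj.
  rewrite big_map big_enum -/(degX b) mcoeff1; case: eqP => //= _.
  congr (nat_of_bool _)%:R; apply/eqP/eqfunP => [/mnmP off0 j|b0].
    have := off0 (rshift n j); rewrite mnmE mnm0E; case: ifP => // /mapP[i _] /eqP.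
    by rewrite eq_rlshift.
  apply/mnmP => i; rewrite mnmE mnm0E; case: ifP => //.
  case: (split_ordP i) => j -> //; rewrite mem_map ?mem_enum //.
  exact: lshift_inj.
rewrite alphaYE mcoeff_mul_Scomplete.
- rewrite big_map big_enum -/(degY a) andbC; case: eqP => //= _.
  rewrite coefX [X in _ && X](_ : _ = true) ?andbT.
    rewrite [in RHS]eqz_nat /degX; congr (nat_of_bool (_ == _))%:R.
    apply: eq_bigr => i _; rewrite mnmE; case: ifP => // /mapP[j _] /eqP.
    by rewrite eq_lrshift.
  by apply/forallP => j; rewrite mnmE map_f ?mem_enum.
- by rewrite map_inj_uniq ?enum_uniq //; exact: rshift_inj.
move=> b _ /mapP[j _ ->] bj; rewrite coefX.
case: forallP => [/(_ j)/eqP b0|_]; last by rewrite andbF.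
by rewrite b0 in bj.
Qed.

(** Adding the letter [1] to an alphabet sums its complete functions. *)
Lemma mcoeff_Scomplete_X1Y (p : int) (q : nat) a :
  (Scomplete (alphaX R n m) p * Scomplete (1 :: alphaY R n m) q)@_a
  = (((degX a)%:Z == p) && (degY a <= q)%N)%:R.
Proof.
elim: q => [|q IHq].
  by rewrite Scomplete0 -(Scomplete0 (alphaY R n m)) mcoeff_Scomplete_XY leqn0.
rewrite Scomplete_cons mul1r mulrDr mcoeffD mcoeff_Scomplete_XY.
have -> : (q.+1 : int) - 1 = q by lia.
rewrite IHq [in RHS]leq_eqVlt ltnS; case: eqP => //= _; last by rewrite addr0.
by case: eqP => [->|_]; rewrite ?ltnn ?addr0 ?add0r.
Qed.

End MonomialExpansion.

(** * The symmetrizing operator *)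

(** The operator acts on fractions through a chosen numerator and denominator;
    this relates them to any other representation of the fraction. *)
Lemma numden_repr (A : idomainType) (f : {fraction A}) :
  f = (\n_(repr f))%:F / (\d_(repr f))%:F.
Proof.
set x := repr f.
have d0 : (\d_x)%:F != 0 :> {fraction A} by rewrite tofrac_eq0 denom_ratioP.
apply: (mulIf d0); rewrite divfK // -[f]reprK -/x !generic_quotient.piE.
apply/eqmodP; rewrite /= FracField.equivfE /FracField.mulf.
by rewrite !numden_Ratio ?mulf_neq0 ?oner_eq0 ?denom_ratioP // !mulr1 mulrC.
Qed.

Lemma exprz_shift (F : fieldType) (y : F) (d : int) (e N : nat) :
  y != 0 -> d = e%:Z - N%:Z -> y ^ d * y ^+ N = y ^+ e.
Proof. by move=> y0 ->; rewrite !exprnP -expfzDr // subrK. Qed.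

Section PiOmega.
Variables (R : idomainType) (N m : nat).
Local Notation T := {mpoly R[N.+1 + m]}.
Local Notation x := (@x_ R N.+1 m).
Implicit Types (s : 'S_N.+1) (p q : T).
Local Notation permX := (@Defs.permX R N.+1 m).

Fact permX_is_zmod_morphism s : zmod_morphism (permX s).
Proof. by move=> p q; exact: comp_mpolyB. Qed.

Fact permX_is_monoid_morphism s : monoid_morphism (permX s).
Proof. by split; [exact: comp_mpoly1 | move=> p q; exact: rmorphM]. Qed.

HB.instance Definition _ s := GRing.isZmodMorphism.Build T T (permX s)
  (permX_is_zmod_morphism s).
HB.instance Definition _ s := GRing.isMonoidMorphism.Build T T (permX s)
  (permX_is_monoid_morphism s).

Lemma permX_x s i : permX s (x i) = x (s i).
Proof.
by rewrite /Defs.permX comp_mpolyXU -tnth_nth tnth_mktuple (unsplitK (inl i)).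
Qed.

Lemma permX_y s j : permX s (y_ R N.+1 j) = y_ R N.+1 j :> T.
Proof.
by rewrite /Defs.permX comp_mpolyXU -tnth_nth tnth_mktuple (unsplitK (inr j)).
Qed.

Lemma permXK s : cancel (permX s) (permX s^-1%g).
Proof.
move=> p; have permXZ t c q : permX t (c *: q) = c *: permX t q.
  exact: comp_mpolyZ.
rewrite {1}[p]mpolyE [RHS]mpolyE (raddf_sum (permX s)).
rewrite (raddf_sum (permX s^-1%g)); apply: eq_bigr => a _ /=.
rewrite -!/(permX _ _) !permXZ; congr (_ *: _).
rewrite [X in permX s X]mpolyXE_id [RHS]mpolyXE_id !rmorph_prod.
apply: eq_bigr => i _; rewrite !rmorphXn /=; congr (_ ^+ _).
by case: (split_ordP i) => k ->; rewrite ?permX_x ?permK ?permX_y // permX_x permK.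
Qed.

Lemma permX_frac_div s p q : q != 0 ->
  permX_frac s (p%:F / q%:F) = (permX s p)%:F / (permX s q)%:F.
Proof.
move=> q0; set f := _ / _; rewrite /Defs.permX_frac; have := numden_repr f.
set a := \n_(repr f); set b := \d_(repr f) => fE.
have b0 : b != 0 by exact: denom_ratioP.
have permX0 r : r != 0 -> (permX s r)%:F != 0 :> {fraction T}.
  by move=> r0; rewrite tofrac_eq0 raddf_eq0 //; exact: can_inj (permXK s).
have : a * q = p * b.
  apply/eqP; rewrite -tofrac_eq !tofracM -eqr_div ?tofrac_eq0 //.
  by rewrite -fE.
move=> /(congr1 (permX s)) /eqP.
rewrite !rmorphM -tofrac_eq !tofracM -eqr_div ?permX0 //.
by move/eqP.
Qed.

Lemma DeltaE : Delta R N.+1 m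
  = \prod_(i < N.+1) \prod_(j < N.+1 | (i < j)%N) (x i - x j).
Proof. by []. Qed.

Lemma x_inj : injective x.
Proof.
move=> i j /(congr1 (fun p => p@_(U_(lshift m i)))).
rewrite !mcoeffXU eqxx; case: eqP => [/lshift_inj //|_] /eqP.
by rewrite oner_eq0.
Qed.

Lemma Delta_neq0 : Delta R N.+1 m != 0.
Proof.
apply/prodf_neq0 => i _; apply/prodf_neq0 => j ij; rewrite subr_eq0.
by apply/eqP => /x_inj eq_ij; rewrite eq_ij ltnn in ij.
Qed.

(** The Vandermonde determinant has its columns permuted. *)
Lemma permX_Delta s : permX s (Delta R N.+1 m) = (-1) ^+ s * Delta R N.+1 m.
Proof.
rewrite DeltaE -Vandermonde_decreasing -det_map_mx.
have -> : map_mx (permX s) (col_mx (power_row x N) (power_rows x) : 'M_N.+1)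
    = col_perm s (col_mx (power_row x N) (power_rows x) : 'M_N.+1).
  apply/matrixP => i j; rewrite !mxE.
  by case: split_ordP => k _; rewrite !mxE rmorphXn /= permX_x.
by rewrite col_permE det_mulmx det_perm odd_permV mulrC.
Qed.

(** On a power of [x_1] the symmetrizing operator is the Leibniz expansion of
    an alternant, divided by the Vandermonde determinant. *)
Lemma pi_omega_x1 (c : T) (d : int) :
    (forall s, permX s c = c) -> (- N%:Z <= d)%R ->
  pi_omega ((x ord0)%:F ^ d * c%:F) = (Scomplete (alphaX R N.+1 m) d * c)%:F.
Proof.
move=> cP dN; pose e := absz (d + N%:Z).
have dE : d = e%:Z - N%:Z by rewrite /e; lia.
have x0 : (x ord0)%:F != 0 :> {fraction T}.
  rewrite tofrac_eq0; apply/eqP => /(congr1 (fun p => p@_(U_(lshift m ord0)))).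
  by rewrite mcoeffXU eqxx mcoeff0 => /eqP; rewrite oner_eq0.
have D0 : (Delta R N.+1 m)%:F != 0 :> {fraction T} by rewrite tofrac_eq0 Delta_neq0.
pose p : T := x ord0 ^+ e * (\prod_(i < N) x (lift ord0 i) ^+ (N.-1 - i)) * c.
have fE : (x ord0)%:F ^ d * c%:F / (Delta R N.+1 m)%:F
    * (\prod_(i < N.+1) x i ^+ (N.+1.-1 - i))%:F = p%:F / (Delta R N.+1 m)%:F.
  have expE := exprz_shift x0 dE.
  rewrite mulrAC; congr (_ / _); rewrite /p !tofracM tofracXn -expE.
  rewrite big_ord_recl /= subn0 tofracM tofracXn -!mulrA; congr (_ * _).
  rewrite mulrCA; congr (_ * _); rewrite mulrC; congr (_%:F * _).
  by apply: eq_bigr => i _; congr (_ ^+ _); rewrite /bump /=; lia.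
have signE s : (permX s p)%:F / (permX s (Delta R N.+1 m))%:F
    = ((-1) ^+ s * permX s p)%:F / (Delta R N.+1 m)%:F.
  rewrite permX_Delta !tofracM invfM tofracXn tofracN tofrac1 invr_sign.
  by rewrite mulrA [_ * _%:F]mulrC.
rewrite /pi_omega fE; under eq_bigr do rewrite permX_frac_div ?Delta_neq0 // signE.
rewrite -mulr_suml; apply: (mulIf D0); rewrite divfK // -rmorph_sum -tofracM.
congr (_%:F); rewrite mulrAC DeltaE dE -alternant_Scomplete /determinant mulr_suml.
apply: eq_bigr => s _; rewrite -mulrA; congr (_ * _).
rewrite /p !rmorphM /= cP rmorphXn /= permX_x rmorph_prod; congr (_ * _).
rewrite [RHS]big_ord_recl col_mx_ord0 mxE; congr (_ * _).
by apply: eq_bigr => i _; rewrite col_mx_lift mxE rmorphXn /= permX_x.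
Qed.

End PiOmega.

(** * The Omega operator *)

Lemma fsum_single (I : choiceType) (V : nmodType) (f : I -> V) (i0 : I) :
  (forall i, i != i0 -> f i = 0) ->
  finite_set [set i | f i != 0] /\ \sum_(i \in [set: I]) f i = f i0.
Proof.
move=> f0; split.
  apply: (sub_finite_set _ (finite_set1 i0)) => i /= fi.
  by apply/eqP; apply: contraNT fi => /f0->.
rewrite -(fsbig_widen [set i0]) ?fsbig_set1 //.
by move=> i [_ /= /eqP /f0].
Qed.

Section OmegaExpansion.
Variables (R : idomainType) (n m : nat) (k : int).
Implicit Type a : 'X_{1..n + m}.

(** The coefficient of a monomial is the indicator of a nonnegative power of
    lambda. *)
Definition Omega_series : {mseries R[n + m]} :=
  MSeries (fun a => ((degY a)%:Z <= k + (degX a)%:Z)%R%:R).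

(** This is the geometric series in the variables [x_i] and [y_j], taken at
    [t = (lambda, ..., lambda, 1 / lambda, ..., 1 / lambda)]. *)
Lemma Omega_integrandE a :
  Omega_integrand R n m k a = lambda R ^ (k + (degX a)%:Z - (degY a)%:Z).
Proof.
pose t (i : 'I_(n + m)) :=
  if fintype.split i is inl _ then lambda R else (lambda R)^-1.
have lambda_neq0 : lambda R != 0 by rewrite /lambda tofrac_eq0 polyX_eq0.
have tl i : t (lshift m i) = lambda R by rewrite /t (unsplitK (inl i)).
have tr i : t (rshift n i) = (lambda R)^-1 by rewrite /t (unsplitK (inr i)).
pose D := \prod_(i < n) (1 - lambda R *: x_ {fraction {poly R}} m i) *
          \prod_(j < m) (1 - (lambda R)^-1 *: y_ {fraction {poly R}} n j).
have DE : \prod_(i < n + m) (1 - t i *: 'X_i) = D.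
  rewrite big_split_ord /D; congr (_ * _); apply: eq_bigr => i _ /=.
    by rewrite tl.
  by rewrite tr.
have := mseries_geometric t; rewrite DE; set G := MSeries _ => GD.
have uD : mseries_of D \is a GRing.unit by apply/unitrPr; exists G; rewrite mulrC.
rewrite /Omega_integrand -/D.
have -> : (mseries_of D)^-1 = G by rewrite -[LHS]mul1r -GD mulrK.
rewrite mseries_mulCX /= big_split_ord /=.
under eq_bigr do rewrite tl.
under [X in _ * (_ * X)]eq_bigr do rewrite tr.
rewrite !prodrXr -/(degX a) -/(degY a) exprVn exprnN exprnP mulrA.
by rewrite -!expfzDr.
Qed.

Lemma is_Omega_series : is_Omega (Omega_integrand R n m k) Omega_series.
Proof.
exists (fun s => MSeries (fun a => (s == k + (degX a)%:Z - (degY a)%:Z)%:R)).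
  move=> a; set s0 := k + (degX a)%:Z - (degY a)%:Z.
  have eq0 (s : int) : s != s0 -> (s == s0)%:R = 0 :> R by move=> /negPf->.
  have [fin _] := fsum_single eq0; split => //; rewrite Omega_integrandE -/s0.
  rewrite [RHS](fsum_single (i0 := s0) _).2 /= ?eqxx ?polyC1 ?tofrac1 ?mul1r //.
  by move=> s /eq0; rewrite /= -/s0 => ->; rewrite polyC0 tofrac0 mul0r.
move=> a; set s0 := k + (degX a)%:Z - (degY a)%:Z.
have eq0 (s : nat) : s != absz s0 -> (s%:Z == s0)%:R = 0 :> R.
  by move=> ss0; case: (eqVneq s%:Z s0) => // ss; rewrite -ss eqxx in ss0.
have [fin sumE] := fsum_single eq0; split => //; rewrite [RHS]sumE /=.
by congr (nat_of_bool _)%:R; rewrite /s0; lia.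
Qed.

End OmegaExpansion.

(** * The rational form *)

Section RationalForm.
Variables (R : idomainType) (N m : nat) (k : int).
Hypothesis k_le_N : (k <= N%:Z)%R.
Local Notation T := {mpoly R[N.+1 + m]}.
Local Notation x := (@x_ R N.+1 m).
Local Notation X := (alphaX R N.+1 m).
Local Notation B := (1 :: alphaY R N.+1 m).
Local Notation e := (absz (N%:Z - k)).

Definition XB_term (j : nat) : T := Scomplete X (j%:Z - k) * Scomplete B j%:Z.

Lemma XB_term_single (a : 'X_{1..N.+1 + m}) (j : nat) :
  j != absz (k + (degX a)%:Z) -> (XB_term j)@_a = 0.
Proof.
move=> ja; rewrite mcoeff_Scomplete_X1Y; case: eqP => //= degXj.
by case/eqP: ja; lia.
Qed.

Lemma Omega_seriesE (a : 'X_{1..N.+1 + m}) :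
  Omega_series R N.+1 m k a = (XB_term (absz (k + (degX a)%:Z)))@_a.
Proof.
by rewrite mcoeff_Scomplete_X1Y /=; congr (nat_of_bool _)%:R; lia.
Qed.

Lemma has_sum_XB_term :
  has_sum (fun j => mseries_of (XB_term j)) (Omega_series R N.+1 m k).
Proof.
move=> a; have [fin sumE] := fsum_single (@XB_term_single a).
by split => //; rewrite Omega_seriesE [RHS]sumE.
Qed.

Lemma is_pi_omega_sum_Omega :
  is_pi_omega_sum (fun j : nat => (x ord0)%:F ^ (j%:Z - k) * (Scomplete B j%:Z)%:F)
    (Omega_series R N.+1 m k).
Proof.
exists XB_term; last exact: has_sum_XB_term.
move=> j; rewrite pi_omega_x1 //; last by lia.
move=> s; rewrite rmorph_Scomplete map_cons rmorph1; congr (Scomplete (_ :: _) _).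
rewrite -map_comp; apply: eq_map => i /=; exact: permX_y.
Qed.

Lemma degXY (a : 'X_{1..N.+1 + m}) : mdeg a = (degX a + degY a)%N.
Proof. by rewrite mdegE big_split_ord. Qed.

(** The complete functions of the first row are homogeneous. *)
Lemma order_ge_Schur_sum t : order_ge (t - N) (Schur_sum x B t).
Proof.
rewrite /Schur_sum det_col_mx; apply: order_ge_sum => p _.
rewrite -[(t - N)%N]addn0; apply: order_geM; last exact: order_ge0.
move=> a adeg; rewrite mxE -[Scomplete _ _]mulr1 -(Scomplete0 (alphaY R N.+1 m)).
rewrite mcoeff_Scomplete_XY; case: eqP => //= degXa.
by move: adeg; rewrite degXY; lia.
Qed.

Lemma R1E : R1 X B = \prod_p (esym_poly B).[x p].
Proof.
rewrite /R1 big_map big_enum; apply: eq_bigr => p _.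
by rewrite horner_esym_poly; apply: eq_bigr => b _; rewrite mulrC.
Qed.

Lemma R1_unit : mseries_of (R1 X B) \is a GRing.unit.
Proof.
rewrite mseries_of_prod big_map; apply/rpred_prod => i _.
rewrite mseries_of_prod; apply/rpred_prod => b _.
apply: mseries_unit_1sub; rewrite -[1%N]addn0.
apply: order_geM; last exact: order_ge0.
move=> a; rewrite ltnS leqn0 mdeg_eq0 => /eqP->.
by rewrite mcoeffX mnm1_eq0.
Qed.

(** Inverting [esym_poly B] up to degree [J] in [Schur_sum_mul] expresses
    [Schur_sum e] by the first [J] terms of the series; what is left over has
    order tending to infinity with [J]. *)
Lemma R1_partial_sum (J : nat) : (0 < J)%N ->
  exists2 p : T, order_ge (e + J - N) p &
    R1 X B * \sum_(j < J) XB_term j = Schur_sum x B e + p.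
Proof.
move=> J_gt0; pose P : {poly T} := \poly_(j < J) Scomplete B j%:Z.
pose K := (J + (size B).+1)%N.
have PQK : (size (P * esym_poly B)%R <= K)%N.
  rewrite (leq_trans (size_polyMleq _ _)) //.
  rewrite (leq_trans (leq_pred _)) //.
  by rewrite leq_add ?size_poly ?size_esym_poly.
have coefPQ t : (t < J)%N -> (P * esym_poly B)`_t = (t == 0%N)%:R.
  move=> tJ; rewrite -(esym_poly_inv_le B (lexx t%:Z)) coefMr.
  apply: eq_bigr => i _; have := ltn_ord i; rewrite ltnS => it.
  rewrite mulrC coef_poly (leq_ltn_trans (leq_subr _ _) tJ).
  by congr (_ * Scomplete _ _); lia.
have sumE : \sum_(j < J) XB_term j
    = \sum_(t < J) P`_t * Scomplete X ((e + t)%N%:Z - N%:Z).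
  apply: eq_bigr => j _; rewrite coef_poly ltn_ord /XB_term [RHS]mulrC.
  by congr (Scomplete _ _ * _); lia.
have := Schur_sum_mul x e PQK (size_poly _ _).
rewrite -R1E -sumE => /mulIf <-; last first.
  by rewrite det_esym_others -DeltaE Delta_neq0.
(* the coefficients of index at least [J] make up the remainder *)
rewrite big_split_ord /=; eexists; last first.
  congr (_ + _); rewrite (bigD1 (Ordinal J_gt0)) //= coefPQ // mul1r addn0.
  rewrite big1 ?addr0 // => t t0; rewrite coefPQ //.
  by rewrite (_ : (t : nat) == 0%N = false) ?mul0r //; exact/negbTE.
apply: order_ge_sum => t _; rewrite -[X in order_ge X]add0n.
apply: order_geM; first exact: order_ge0.
move=> a adeg; apply: order_ge_Schur_sum; lia.
Qed.

Lemma Omega_series_rational :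
  Omega_series R N.+1 m k = mseries_of (Schur_sum x B e) / mseries_of (R1 X B).
Proof.
apply: (mulIr R1_unit); rewrite divrK ?R1_unit //; apply: mseriesP => a.
(* far enough for the discarded terms of the series, of degree [j - k] in the
   first variables, and the remainder to lie in degrees above that of [a] *)
pose J := (mdeg a + absz k).+1.
rewrite (@eq_mseries_mul _ _ _ (mseries_of (\sum_(j < J) XB_term j)) _
  (mseries_of (R1 X B))) => [|b ba|//]; last first.
  rewrite Omega_seriesE [RHS](raddf_sum (mcoeff b)) /=.
  have bJ : (absz (k + (degX b)%:Z)%R < J)%N by move: ba; rewrite degXY /J; lia.
  rewrite (bigD1 (Ordinal bJ)) //= big1 ?addr0 // => j jb.
  exact: XB_term_single.
have [p p_ord pE] := @R1_partial_sum J isT.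
rewrite -mseries_ofM mulrC pE /= mcoeffD p_ord ?addr0 // /J; lia.
Qed.

End RationalForm.

Theorem theorem0p4 (R : idomainType) (n m : nat) (k : int)
    (n_gt0 : (0 < n)%N) (k_lt_n : (k < n%:Z)%R) :
  let x1 : {mpoly R[n + m]} := x_ R m (Ordinal n_gt0) in
  let X : seq {mpoly R[n + m]} := alphaX R n m in
  let B : seq {mpoly R[n + m]} := 1 :: alphaY R n m in
  let term (mu : n.-1.-tuple nat) : {mpoly R[n + m]} :=
    (-1) ^+ sumn mu * schurS B (map Posz (conjugate mu))
                    * schurS X (- k :: map Posz mu) in
  exists F : {mseries R[n + m]},
    [/\ is_pi_omega_sum
          (fun j : nat => x1%:F ^ (j%:Z - k) * (Scomplete B j%:Z)%:F) F,
        is_Omega (Omega_integrand R n m k) F,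
        finite_set [set mu | partitions mu /\ term mu != 0]
      & F = mseries_of (\sum_(mu \in @partitions n.-1) term mu)
            / mseries_of (R1 X B)].
Proof.
case: n n_gt0 k_lt_n => [//|N] n_gt0 k_lt_n x1 X B term.
have k_le_N : (k <= N%:Z)%R by lia.
exists (Omega_series R N.+1 m k); split.
- have -> : x1 = x_ R m ord0 by congr (x_ R m _); exact: val_inj.
  exact: is_pi_omega_sum_Omega.
- exact: is_Omega_series.
- exact: (finite_Schur_term (@x_ R N.+1 m) B (- k)).
rewrite Omega_series_rational // Schur_sum_partitions.
have -> : (absz (N%:Z - k))%:Z - N%:Z = - k by lia.
by [].
Qed.
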